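(* Assume the uniform PL$^\circ$ condition (with constant $\mu$) and the regularity conditions. Then the function $F_{\max}:\Theta\to\mathbb R$, $F_{\max}(\theta)=\max_{x\in\mathcal S(\theta)}f(\theta,x)$, is Lipschitz continuous on $\Theta$ with constant $$L_{F_{\max},1}:=L_{f,1}\left(1+\frac{2L_{g,\theta x}}{\mu}\right).$$
   Context: Setting: $m\ge1$, $d\ge2$; $\Theta\subset\mathbb R^m$ is a nonempty compact convex set; $f,g:\Theta\times\mathbb R^d\to\mathbb R$; $\|\cdot\|$ is the Euclidean norm (or induced operator norm); $\partial_\theta,\partial_x$ are the gradients in the first/second argument and $\partial_x^2$ is the Hessian in $x$. $\mathcal S(\theta):=\operatorname{argmin}_{x\in\mathbb R^d}g(\theta,x)$. PL$^\circ$: a $\mathcal C^1$ function $h:\mathbb R^d\to\mathbb R$ with set of local minima $\mathcal M$ is locally PL with constant $\mu>0$ if every connected component $\mathcal M'$ of $\mathcal M$ has an open neighborhood $\mathcal N(\mathcal M')\supset\mathcal M'$ with $h(x)-\min_{x'\in\mathcal N(\mathcal M')}h(x')\le(2\mu)^{-1}\|\nabla h(x)\|^2$ for all $x\in\mathcal N(\mathcal M')$. $h$ satisfies the PL$^\circ$ condition with constant $\mu$ if (a) $h\in\mathcal C^2$, $h$ is locally PL with constant $\mu$, and $h$ is $\mathcal C^4$ on every $\mathcal N(\mathcal M')$; (b) every $x\notin\bigcup_{\mathcal M'}\mathcal N(\mathcal M')$ with $\nabla h(x)=0$ satisfies $\nabla^2h(x)\prec0$; (c) $\mathcal M$ is contained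 in a compact set. Uniform PL$^\circ$ condition: there is one $\mu>0$ such that for every $\theta\in\Theta$, $g(\theta,\cdot)$ satisfies the PL$^\circ$ condition with constant $\mu$ (the neighborhoods may depend on $\theta$). Regularity conditions (constants independent of $\theta$): (i) $f$ is $\mathcal C^1$ and $L_{f,1}$-Lipschitz with respect to $(\theta,x)$, and $|f(\theta,x)|\le C_f\|x\|^{\mathsf n_f}+D_f$ for all $x$, with $C_f,D_f\ge0$ and an integer $\mathsf n_f\ge1$. (ii) $g$ has a $\mathcal C^2$ extension to an open neighborhood of $\Theta\times\mathbb R^d$; $\|\partial_xg(\theta,x)-\partial_xg(\theta,x')\|\le L_{g,xx}\|x-x'\|$ and $\|\partial_xg(\theta,x)-\partial_xg(\theta',x)\|\le L_{g,\theta x}\|\theta-\theta'\|$ for all $\theta,\theta'\in\Theta$, $x,x'\in\mathbb R^d$; and $\|\partial_\theta g(\theta,x)\|\le C_g\|x\|^{\mathsf n_g}+D_g$ with $C_g,D_g\ge0$, integer $\mathsf n_g\ge1$. (iii) $\partial_x^2g$ is continuous in $(\theta,x)$. (iv) There are $r_3>0$, $L_{g,3}<\infty$ with $\|\partial_x^2g(\theta,x)-\partial_x^2g(\theta,y)\|\le L_{g,3}\|x-y\|$ for all $\theta\in\Theta$ and all $x,y$ with $\max\{\operatorname{dist}(x,\mathcal S(\theta)),\operatorname{dist}(y,\mathcal S(\theta))\}\le r_3$. (v) There are $\mathsf D_{\mathsf{eb}},\nu_{\mathsf{eb}}>0$ with $\|\partial_xg(\theta,x)\|\ge\nu_{\mathsf{eb}}\operatorname{dist}(x,\mathcal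 S(\theta))$ for all $\theta\in\Theta$, $\|x\|\ge\mathsf D_{\mathsf{eb}}$. *)

(* Defs.v *)
From mathcomp Require Import all_boot all_order all_algebra.
From mathcomp Require Import all_classical all_reals all_analysis.

Set Implicit Arguments.
Unset Strict Implicit.
Unset Printing Implicit Defensive.

Import Order.TTheory GRing.Theory Num.Theory.
Import numFieldNormedType.Exports.

Local Open Scope classical_set_scope.
Local Open Scope ring_scope.

(* The library norm on 'rV[R]_n is the sup norm. It is used here only through  *)
(* its topology and differentials, which are the same for all norms on R^n;   *)
(* quantitative estimates use the Euclidean norm [enorm].                      *)
Definition enorm {R : realType} {n : nat} (v : 'rV[R]_n) : R :=
  Num.sqrt (\sum_i v 0 i ^+ 2).

(* Row vectors are acted on from the right; A and its transpose have the same  *)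
(* operator norm.                                                              *)
Definition opnorm {R : realType} {n : nat} (A : 'M[R]_n) : R :=
  sup [set enorm (v *m A) | v in [set v : 'rV[R]_n | enorm v <= 1]].

(* Extended-real valued, so that the distance to the empty set is +oo.         *)
Definition edist_set {R : realType} {n : nat} (x : 'rV[R]_n) (A : set 'rV[R]_n)
    : \bar R :=
  ereal_inf [set (enorm (x - y))%:E | y in A].

Definition gradient {R : realType} {n : nat} (h : 'rV[R]_n -> R)
    (x : 'rV[R]_n) : 'rV[R]_n :=
  \row_i 'D_(delta_mx 0 i) h x.

Definition hessian {R : realType} {n : nat} (h : 'rV[R]_n -> R)
    (x : 'rV[R]_n) : 'M[R]_n :=
  \matrix_(i, j) 'D_(delta_mx 0 i) ('D_(delta_mx 0 j) h) x.

Definition negative_definite {R : realType} {n : nat} (A : 'M[R]_n) : Prop :=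
  forall v : 'rV[R]_n, v != 0 -> (v *m A *m v^T) 0 0 < 0.

(* C^k on a set U that is meant to be open, in a finite-dimensional space V.   *)
Fixpoint Ck_on {R : realType} {V : normedModType R} (k : nat) (U : set V)
    (h : V -> R) : Prop :=
  match k with
  | 0 => forall x, U x -> {for x, continuous h}
  | k'.+1 => (forall x, U x -> differentiable h x) /\
             (forall v : V, Ck_on k' U ('D_v h))
  end.

(* [he] is C^k on an open neighborhood of D and agrees with [h] on D.          *)
Definition Ck_extension {R : realType} {V : normedModType R} (k : nat)
    (D : set V) (h he : V -> R) : Prop :=
  exists U : set V, [/\ open U, D `<=` U, Ck_on k U he &
                        forall p, D p -> he p = h p].

Definition local_minima {R : realType} {n : nat} (h : 'rV[R]_n -> R)
    : set 'rV[R]_n :=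
  [set x | \forall y \near x, h x <= h y].

Definition components {T : topologicalType} (A : set T) : set (set T) :=
  connected_component A @` A.

Definition argmin {R : realType} {n : nat} (h : 'rV[R]_n -> R)
    : set 'rV[R]_n :=
  [set x | forall y, h x <= h y].

(* [N] assigns to each component M' of the local minima its neighborhood N(M').*)
(* The point x0 realizes the minimum of h over N(M').                          *)
Definition PL_neighborhoods {R : realType} {n : nat} (mu : R)
    (h : 'rV[R]_n -> R) (N : set 'rV[R]_n -> set 'rV[R]_n) : Prop :=
  forall M' : set 'rV[R]_n, components (local_minima h) M' ->
    [/\ open (N M'), M' `<=` N M' &
        exists x0, [/\ N M' x0, forall x, N M' x -> h x0 <= h x &
          forall x, N M' x ->
            h x - h x0 <= (2 * mu)^-1 * enorm (gradient h x) ^+ 2]].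

Definition locally_PL_with {R : realType} {n : nat} (mu : R)
    (h : 'rV[R]_n -> R) (N : set 'rV[R]_n -> set 'rV[R]_n) : Prop :=
  [/\ 0 < mu, Ck_on 1 setT h & PL_neighborhoods mu h N].

(* The PL° condition; all clauses refer to the same neighborhoods.             *)
Definition PLo {R : realType} {n : nat} (mu : R) (h : 'rV[R]_n -> R) : Prop :=
  exists N : set 'rV[R]_n -> set 'rV[R]_n,
    [/\ [/\ Ck_on 2 setT h,
            locally_PL_with mu h N &
            forall M', components (local_minima h) M' -> Ck_on 4 (N M') h],
        forall x, ~ (\bigcup_(M' in components (local_minima h)) N M') x ->
          gradient h x = 0 -> negative_definite (hessian h x) &
        exists2 K : set 'rV[R]_n, compact K & local_minima h `<=` K].

Definition uniform_PLo {R : realType} {m d : nat} (mu : R)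
    (Theta : set 'rV[R]_m) (g : 'rV[R]_m -> 'rV[R]_d -> R) : Prop :=
  forall t, Theta t -> PLo mu (g t).

(* Only the values of f and g on Theta x R^d matter. Since Theta may have      *)
(* empty interior, f being C^1 and the gradient of g in theta are understood   *)
(* through an extension to an open neighborhood of Theta x R^d.                *)
Record regularity {R : realType} {m d : nat} (Theta : set 'rV[R]_m)
    (f g : 'rV[R]_m -> 'rV[R]_d -> R) (Lf1 Lgtx : R) : Prop := Regularity {
  f_C1 : exists fe : 'rV[R]_m * 'rV[R]_d -> R,
    Ck_extension 1 (Theta `*` setT) (fun p => f p.1 p.2) fe;
  f_lipschitz : forall t t' x x', Theta t -> Theta t' ->
    `|f t x - f t' x'| <= Lf1 * enorm (row_mx (t - t') (x - x'));
  f_growth : exists (Cf Df : R) (nf : nat), [/\ 0 <= Cf, 0 <= Df, (1 <= nf)%N &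
    forall t x, Theta t -> `|f t x| <= Cf * enorm x ^+ nf + Df];
  g_C2 : exists ge : 'rV[R]_m * 'rV[R]_d -> R,
    Ck_extension 2 (Theta `*` setT) (fun p => g p.1 p.2) ge /\
    exists (Cg Dg : R) (ng : nat), [/\ 0 <= Cg, 0 <= Dg, (1 <= ng)%N &
      forall t x, Theta t ->
        enorm (gradient (fun t' => ge (t', x)) t) <= Cg * enorm x ^+ ng + Dg];
  g_lipschitz_xx : exists Lgxx : R, forall t x x', Theta t ->
    enorm (gradient (g t) x - gradient (g t) x') <= Lgxx * enorm (x - x');
  g_lipschitz_tx : forall t t' x, Theta t -> Theta t' ->
    enorm (gradient (g t) x - gradient (g t') x) <= Lgtx * enorm (t - t');
  g_hessian_continuous :
    {within Theta `*` setT,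
      continuous (fun p : 'rV[R]_m * 'rV[R]_d => hessian (g p.1) p.2)};
  g_hessian_lipschitz : exists r3 Lg3 : R, 0 < r3 /\
    forall t x y, Theta t ->
      (maxe (edist_set x (argmin (g t))) (edist_set y (argmin (g t)))
        <= r3%:E)%E ->
      opnorm (hessian (g t) x - hessian (g t) y) <= Lg3 * enorm (x - y);
  g_error_bound : exists Deb nueb : R, [/\ 0 < Deb, 0 < nueb &
    forall t x, Theta t -> Deb <= enorm x ->
      (nueb%:E * edist_set x (argmin (g t))
        <= (enorm (gradient (g t) x))%:E)%E]
}.

Definition Fmax {R : realType} {m d : nat}
    (f g : 'rV[R]_m -> 'rV[R]_d -> R) (t : 'rV[R]_m) : R :=
  sup [set f t x | x in argmin (g t)].

(* Main.v *)
Require Import Defs.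
From mathcomp Require Import all_boot all_order all_algebra.
From mathcomp Require Import all_classical all_reals all_analysis.
From mathcomp Require Import ring lra.
Set Implicit Arguments.
Unset Strict Implicit.
Unset Printing Implicit Defensive.
Import Order.TTheory GRing.Theory Num.Theory.
Import numFieldNormedType.Exports.
Local Open Scope classical_set_scope.
Local Open Scope ring_scope.

(** Write [h] for [g t], [m] for its minimum and [S] for its set of minimizers,
    and [k] for [2 * Lgtx / mu]. The theorem follows once [t |-> argmin (g t)]
    is known to be locally [k]-Lipschitz for the Hausdorff distance
    ([argmin_locally_lipschitz]): comparing maximizers of [f t] and [f t'] then
    gives the estimate for [Fmax] near every point of [Theta], and a segment of
    the convex set [Theta] propagates it. Three facts carry the Hausdorff
    estimate.

    First, a uniform error bound: [mu / 2 * dist(x, S) <= |grad h x|] as soon as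
    [dist(x, S) <= r], where [r] depends on the constants only
    ([uniform_error_bound]). The PL neighborhoods may shrink with [t], but they
    only serve infinitesimally: on the segment from [x] to its projection [p]
    on [S], arbitrarily close to [p], the PL inequality and Ekeland's principle
    give an error bound, hence [|(x - p) H(p)| >= (3 / 4) mu |x - p|] for the
    Hessian [H], up to an error of second order; the uniform Lipschitz bound of
    [H] brings this back to [x].

    Second, [S] is connected, in the form of an intermediate value property
    ([mountain_pass]). If a level set of a continuous function separated two
    minimizers, there would be a level [c] at which two separate parts of
    [h < c] meet. But every critical point is a local minimum, which is not
    adherent to [h < c] at that level, or a nondegenerate local maximum, around
    which [h < c] is a punctured ball, connected as [2 <= d]; and regular points
    cannot join two parts of [h < c] either. Sublevel sets are compact by the
    error bound at infinity.

    Third, the minimizers of [g t] are close to those of [g t0] when [t] is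
    close to [t0] ([upper_hemicontinuous]), a compactness argument.

    Now if [x] minimizes [g t], then [|grad (g t0) x| <= Lgtx |t - t0|], so that
    the error bound improves [dist(x, argmin (g t0)) <= r] to [k |t - t0|].
    Conversely the distance to [argmin (g t)] takes on [argmin (g t0)] no value
    between [k |t - t0|] and [r], and it takes a value below [r] by the third
    fact, so that it stays below [k |t - t0|] by connectedness. *)

(** * Euclidean norm *)

Section EuclideanNorm.
Context {R : realType} {n : nat}.
Implicit Types u v w : 'rV[R]_n.

Definition dotp u v : R := \sum_i u 0 i * v 0 i.

Lemma dotpC u v : dotp u v = dotp v u.
Proof. by apply: eq_bigr => i _; rewrite mulrC. Qed.

Lemma dotpDl u v w : dotp (u + v) w = dotp u w + dotp v w.
Proof. by rewrite -big_split; apply: eq_bigr => i _; rewrite mxE mulrDl. Qed.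

Lemma dotpZl a u w : dotp (a *: u) w = a * dotp u w.
Proof. by rewrite mulr_sumr; apply: eq_bigr => i _; rewrite mxE mulrA. Qed.

Lemma dotpNl u w : dotp (- u) w = - dotp u w.
Proof. by rewrite -scaleN1r dotpZl mulN1r. Qed.

Lemma dotpBl u v w : dotp (u - v) w = dotp u w - dotp v w.
Proof. by rewrite dotpDl dotpNl. Qed.

Lemma dotpDr u v w : dotp u (v + w) = dotp u v + dotp u w.
Proof. by rewrite dotpC dotpDl !(dotpC u). Qed.

Lemma dotpZr a u w : dotp u (a *: w) = a * dotp u w.
Proof. by rewrite dotpC dotpZl dotpC. Qed.

Lemma dotpBr u v w : dotp u (v - w) = dotp u v - dotp u w.
Proof. by rewrite dotpC dotpBl !(dotpC u). Qed.

Lemma dotp_ge0 u : 0 <= dotp u u.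
Proof. by apply: sumr_ge0 => i _; rewrite -expr2 sqr_ge0. Qed.

Lemma enormE u : enorm u = Num.sqrt (dotp u u).
Proof. by congr Num.sqrt; apply: eq_bigr => i _; rewrite expr2. Qed.

Lemma enorm_ge0 u : 0 <= enorm u.
Proof. exact: sqrtr_ge0. Qed.

Lemma enorm_sqr u : enorm u ^+ 2 = dotp u u.
Proof. by rewrite enormE sqr_sqrtr// dotp_ge0. Qed.

Lemma coord_le_enorm u i : `|u 0 i| <= enorm u.
Proof.
rewrite -(ler_pXn2r (n := 2)) ?nnegrE ?enorm_ge0// enorm_sqr.
rewrite real_normK ?num_real//.
rewrite /dotp (bigD1 i)//= -expr2 lerDl.
by apply: sumr_ge0 => j _; rewrite -expr2 sqr_ge0.
Qed.

Lemma enorm_eq0 u : enorm u = 0 -> u = 0.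
Proof.
move=> u0; apply/rowP => i; rewrite mxE; apply/eqP.
by rewrite -normr_le0 -u0 coord_le_enorm.
Qed.

Lemma enorm0 : enorm (0 : 'rV[R]_n) = 0.
Proof. by rewrite enormE /dotp big1 ?sqrtr0// => i _; rewrite mxE mul0r. Qed.

Lemma enorm_gt0 u : u != 0 -> 0 < enorm u.
Proof.
by move=> u0; rewrite lt0r enorm_ge0 andbT; apply: contra u0 => /eqP/enorm_eq0->.
Qed.

Lemma enormZ a u : enorm (a *: u) = `|a| * enorm u.
Proof.
by rewrite !enormE dotpZl dotpZr mulrA -expr2 sqrtrM ?sqr_ge0// sqrtr_sqr.
Qed.

Lemma enormN u : enorm (- u) = enorm u.
Proof. by rewrite -scaleN1r enormZ normrN1 mul1r. Qed.

Lemma enormC u v : enorm (u - v) = enorm (v - u).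
Proof. by rewrite -enormN opprB. Qed.

(** Cauchy-Schwarz, from the nonnegativity of [|(v.v) u - (u.v) v|^2]. *)
Lemma dotp_le u v : dotp u v <= enorm u * enorm v.
Proof.
have [->|v0] := eqVneq v 0.
  by rewrite enorm0 mulr0 /dotp big1// => i _; rewrite mxE mulr0.
apply: (le_trans (ler_norm _)).
rewrite -(ler_pXn2r (n := 2)) ?nnegrE ?mulr_ge0 ?enorm_ge0//.
rewrite real_normK ?num_real// exprMn !enorm_sqr.
have vv : 0 < dotp v v by rewrite -enorm_sqr exprn_gt0// enorm_gt0.
have := dotp_ge0 (dotp v v *: u - dotp u v *: v).
rewrite dotpBl !dotpBr !dotpZl !dotpZr (dotpC v u) => H.
have {H} : 0 <= dotp v v * (dotp u u * dotp v v - dotp u v ^+ 2).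
  by apply: le_trans H _; rewrite le_eqVlt; apply/orP; left; apply/eqP; ring.
by rewrite pmulr_rge0// subr_ge0.
Qed.

Lemma enormD u v : enorm (u + v) <= enorm u + enorm v.
Proof.
rewrite -(ler_pXn2r (n := 2)) ?nnegrE ?addr_ge0 ?enorm_ge0//.
rewrite sqrrD !enorm_sqr dotpDl !dotpDr (dotpC v u).
have := dotp_le u v; lra.
Qed.

Lemma enormB_triangle u v w : enorm (u - w) <= enorm (u - v) + enorm (v - w).
Proof. by have := enormD (u - v) (v - w); rewrite addrA subrK. Qed.

Lemma enorm_dist u v : `|enorm u - enorm v| <= enorm (u - v).
Proof.
rewrite ler_norml; apply/andP; split.
  by have := enormD (v - u) u; rewrite subrK (enormC v u); lra.
by have := enormD (u - v) v; rewrite subrK; lra.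
Qed.

Lemma norm_le_enorm u : `|u| <= enorm u.
Proof.
have -> : `|u| = mx_norm u by [].
have [->|] := eqVneq (mx_norm u) 0; first exact: enorm_ge0.
by move=> /mx_norm_neq0[[i j] ->]; rewrite ord1 coord_le_enorm.
Qed.

Lemma coord_le_norm u i : `|u 0 i| <= `|u|.
Proof.
have -> : `|u| = mx_norm u by [].
rewrite mx_normE; set F := fun ij : 'I_1 * 'I_n => `|u ij.1 ij.2|%:nng.
by have : F (0, i) <= \big[Num.max/0%:nng]_ij F ij by exact: le_bigmax.
Qed.

(** The factor [n.+1], instead of [Num.sqrt n], can be divided by even if [n] is
    zero. *)
Lemma enorm_le_norm u : enorm u <= n.+1%:R * `|u|.
Proof.
rewrite -(ler_pXn2r (n := 2)) ?nnegrE ?mulr_ge0 ?enorm_ge0//.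
rewrite enorm_sqr exprMn.
have le1 : dotp u u <= \sum_(i < n) `|u| ^+ 2.
  apply: ler_sum => i _; rewrite -expr2 -[leLHS]real_normK ?num_real//.
  by rewrite ler_pXn2r ?nnegrE// coord_le_norm.
apply: (le_trans le1); rewrite sumr_const card_ord -[leLHS]mulr_natl.
rewrite ler_wpM2r ?sqr_ge0// -natrX ler_nat.
by rewrite (leq_trans (leqnSn n))// expnS leq_pmulr.
Qed.

Lemma nbhs_enormP (x : 'rV[R]_n) (P : set 'rV[R]_n) :
  nbhs x P <-> exists2 e, 0 < e & forall y, enorm (y - x) < e -> P y.
Proof.
split.
  move=> /nbhs_normP[e e0 eP]; exists e => // y yx; apply: eP => /=.
  by rewrite distrC (le_lt_trans (norm_le_enorm _)).
move=> [e e0 eP]; apply/(nbhs_normP x P); exists (e / n.+1%:R) => /=.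
  by rewrite divr_gt0.
move=> y /=; rewrite distrC ltr_pdivlMr// mulrC => yx.
by apply: eP; rewrite (le_lt_trans (enorm_le_norm _)).
Qed.

Lemma continuous_enormP (f : 'rV[R]_n -> R) x :
  {for x, continuous f} <->
  (forall e, 0 < e ->
   exists2 r, 0 < r & forall y, enorm (y - x) < r -> `|f y - f x| < e).
Proof.
split.
  move=> /(proj1 (@cvgrPdist_lt _ _ _ _ (nbhs_filter x) f (f x))) fx e e0.
  have /nbhs_enormP[r r0 rP] := fx e e0.
  by exists r => // y /rP; rewrite distrC.
move=> H; apply/(proj2 (@cvgrPdist_lt _ _ _ _ (nbhs_filter x) f (f x))) => e e0.
have [r r0 rP] := H e e0; apply/nbhs_enormP.
by exists r => // y /rP; rewrite distrC.
Qed.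

Lemma lipschitz_enorm_continuous (f : 'rV[R]_n -> R) (k : R) :
  (forall x y, `|f x - f y| <= k * enorm (x - y)) -> continuous f.
Proof.
move=> fk x; apply/continuous_enormP => e e0.
exists (e / (`|k| + 1)); first by rewrite divr_gt0// ltr_wpDl.
move=> y; rewrite ltr_pdivlMr ?ltr_wpDl// => H.
apply: le_lt_trans (fk y x) _; apply: le_lt_trans H.
by rewrite mulrC ler_wpM2l ?enorm_ge0// (le_trans (ler_norm _))// lerDl.
Qed.

Lemma enorm_continuous : continuous (@enorm R n).
Proof.
by apply: (@lipschitz_enorm_continuous _ 1) => x y; rewrite mul1r enorm_dist.
Qed.

Lemma closed_enorm_compact (A : set 'rV[R]_n) (r : R) :
  closed A -> (forall x, A x -> enorm x <= r) -> compact A.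
Proof.
move=> cA Ar; apply: bounded_closed_compact => //.
exists r; split; first exact: num_real.
move=> M rM x /Ar xr; apply: (le_trans (norm_le_enorm _)).
exact: le_trans xr (ltW rM).
Qed.

Lemma compact_enorm_bounded (A : set 'rV[R]_n) :
  compact A -> exists2 r, 0 < r & forall x, A x -> enorm x <= r.
Proof.
move=> cA; have [->|/set0P A0] := eqVneq A set0; first by exists 1.
have [] := @compact_EVT_max _ _ (@enorm R n) A A0 cA.
  by apply: continuous_subspaceT; exact: enorm_continuous.
move=> c _ cmax; exists (enorm c + 1); first by rewrite ltr_wpDl ?enorm_ge0.
by move=> x /mem_set/cmax; lra.
Qed.

Lemma closed_le_continuous (f : 'rV[R]_n -> R) (c : R) :
  continuous f -> closed [set x | f x <= c].
Proof.
by move=> fc; apply: (@closed_comp _ _ f [set y | y <= c]) => // x _; exact: fc.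
Qed.

Lemma closed_ge_continuous (f : 'rV[R]_n -> R) (c : R) :
  continuous f -> closed [set x | c <= f x].
Proof.
by move=> fc; apply: (@closed_comp _ _ f [set y | c <= y]) => // x _; exact: fc.
Qed.

Lemma compact_min (f : 'rV[R]_n -> R) (A : set 'rV[R]_n) :
  continuous f -> compact A -> A !=set0 ->
  exists2 x, A x & forall y, A y -> f x <= f y.
Proof.
move=> fc cA A0.
have [|x /set_mem xA xm] := compact_EVT_min A0 cA (f := f).
  exact: continuous_subspaceT.
by exists x => // y /mem_set/xm.
Qed.

End EuclideanNorm.

(** * Directional derivatives and Taylor expansion *)

Section Calculus.
Context {R : realType} {n : nat}.
Implicit Types (h : 'rV[R]_n -> R) (x y u v w : 'rV[R]_n).

Lemma derive_dotp_gradient h x v :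
  differentiable h x -> 'D_v h x = dotp v (gradient h x).
Proof.
move=> dh; rewrite deriveE// [in LHS](row_sum_delta v) linear_sum.
apply: eq_bigr => i _; rewrite linearZ /= mxE deriveE//.
Qed.

Lemma derive_line h x w (s : R) : differentiable h (x + s *: w) ->
  is_derive s 1 (fun s => h (x + s *: w)) ('D_w h (x + s *: w)).
Proof.
move=> dh; have dd := diff_derivable (v := w) dh.
have E : (fun k : R => k^-1 *: (h (x + (k *: (1 : R) + s) *: w) - h (x + s *: w)))
  = (fun k : R => k^-1 *: (h (k *: w + (x + s *: w)) - h (x + s *: w))).
  by apply/funext => k; rewrite scalerDl addrCA -[k *: 1]/(k * 1) mulr1.
by apply: DeriveDef; rewrite /derivable /derive E.
Qed.

Lemma mean_value h x w : (forall y, differentiable h y) ->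
  exists t, [/\ 0 < t, t < 1 & h (x + w) - h x = 'D_w h (x + t *: w)].
Proof.
move=> dh; have hw (s : R) :
    is_derive s 1 (fun s => h (x + s *: w)) ('D_w h (x + s *: w)).
  exact: derive_line.
have [] := @MVT R (fun s => h (x + s *: w))
  (fun s => 'D_w h (x + s *: w)) 0 1 ltr01.
- apply: continuous_subspaceT => s; apply: differentiable_continuous.
  by apply/derivable1_diffP; have [] := hw s.
- move=> t; rewrite in_itv /= => /andP[t0 t1].
  by rewrite scale1r scale0r addr0 subr0 mulr1 => H; exists t.
Qed.

Lemma derive_approx h x v : differentiable h x -> forall e, 0 < e ->
  exists2 r, 0 < r & forall t, 0 < t -> t < r ->
    `|t^-1 * (h (x + t *: v) - h x) - 'D_v h x| < e.
Proof.
move=> /(diff_derivable (v := v)) dh e e0.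
have /cvgrPdist_lt/(_ e e0) /= : (fun t : R => t^-1 *: (h (t *: v + x) - h x))
  @ 0^' --> 'D_v h x by exact: dh.
rewrite near_withinE => /nbhs_normP[r r0 rP]; exists r => // t t0 tr.
rewrite distrC [x + _]addrC; apply: rP; last by rewrite gt_eqF.
by rewrite /= sub0r normrN gtr0_norm.
Qed.

(** Testing the hypothesis in the direction of steepest descent. *)
Lemma slope_gradient_le h y c : differentiable h y -> 0 <= c ->
  (forall z, h y <= h z + c * enorm (z - y)) -> enorm (gradient h y) <= c.
Proof.
move=> dh c0 H; set g := gradient h y.
have [->|g0] := eqVneq g 0; first by rewrite enorm0.
have gp := enorm_gt0 g0.
rewrite leNgt; apply/negP => cg.
have e0 : 0 < enorm g * (enorm g - c) by rewrite mulr_gt0// subr_gt0.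
have [r r0 rP] := derive_approx (- g) dh e0.
have r20 : 0 < r / 2 by lra.
have /rP : r / 2 < r by lra.
move=> /(_ r20); rewrite ltr_norml => /andP[_].
rewrite derive_dotp_gradient// dotpNl -enorm_sqr -/g.
have := H (y + (r / 2) *: - g).
have -> : y + (r / 2) *: - g - y = (r / 2) *: - g by rewrite addrC addKr.
rewrite enormZ enormN gtr0_norm// => Hy.
have : - (c * enorm g) <= (r / 2)^-1 * (h (y + (r / 2) *: - g) - h y).
  by rewrite ler_pdivlMl//; move: Hy; rewrite mulrN; lra.
by move=> A B; have := le_lt_trans A
  (_ : _ < enorm g * (enorm g - c) - enorm g ^+ 2); lra.
Qed.

Lemma derive2_hessian h x u w : (forall y, differentiable h y) ->
  (forall v y, differentiable ('D_v h) y) ->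
  'D_w ('D_u h) x = dotp (w *m hessian h x) u.
Proof.
move=> dh d2h.
have -> : 'D_u h = (\sum_i (fun y => u 0 i *: 'D_(delta_mx 0 i) h y)).
  apply/funext => y; rewrite derive_dotp_gradient// fct_sumE.
  by apply: eq_bigr => i _; rewrite mxE.
rewrite derive_sum; last first.
  by move=> i; apply: derivableZ; exact: diff_derivable.
apply: eq_bigr => i _; rewrite deriveZ; last exact: diff_derivable.
rewrite derive_dotp_gradient// /dotp /= mulrC; congr (_ * _).
by rewrite mxE; apply: eq_bigr => j _; rewrite !mxE.
Qed.

Lemma enorm_mulmx_bounded (A : 'M[R]_n) :
  exists2 C, 0 <= C & forall v, enorm (v *m A) <= C * enorm v.
Proof.
pose a j := enorm (row j A^T); pose C2 := \sum_j a j ^+ 2.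
have C20 : 0 <= C2 by apply: sumr_ge0 => j _; exact: sqr_ge0.
exists (Num.sqrt C2) => [|v]; first exact: sqrtr_ge0.
rewrite -(ler_pXn2r (n := 2)) ?nnegrE ?mulr_ge0 ?enorm_ge0 ?sqrtr_ge0//.
rewrite exprMn enorm_sqr (sqr_sqrtr C20) mulr_suml; apply: ler_sum => j _.
have -> : (v *m A) 0 j = dotp v (row j A^T).
  by rewrite mxE; apply: eq_bigr => i _; rewrite !mxE.
rewrite -expr2 -exprMn -[leLHS]real_normK ?num_real//.
rewrite ler_pXn2r ?nnegrE ?mulr_ge0 ?enorm_ge0// mulrC ler_norml dotp_le andbT.
by rewrite lerNl -dotpNl (le_trans (dotp_le _ _))// enormN.
Qed.

Lemma enorm_mulmx_le (A : 'M[R]_n) v : enorm (v *m A) <= opnorm A * enorm v.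
Proof.
have [->|v0] := eqVneq v 0; first by rewrite mul0mx !enorm0 mulr0.
have vp := enorm_gt0 v0.
have : enorm ((enorm v)^-1 *: v *m A) <= opnorm A.
  apply: ub_le_sup.
    have [C C0 CP] := enorm_mulmx_bounded A.
    exists C => _ [w w1 <-]; apply: (le_trans (CP w)).
    by rewrite -[leRHS]mulr1 ler_wpM2l.
  exists ((enorm v)^-1 *: v) => //=.
  by rewrite enormZ ger0_norm ?invr_ge0 ?enorm_ge0// mulVf// gt_eqF.
rewrite -scalemxAl enormZ ger0_norm ?invr_ge0 ?enorm_ge0//.
by rewrite ler_pdivrMl// mulrC.
Qed.

(** For [gradient_taylor], where [u] is the remainder and the mean value theorem
    provides the second hypothesis. *)
Lemma residual_dotp u v w (A B : 'M[R]_n) : u = v - w *m A ->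
  dotp v u = dotp (w *m B) u -> dotp u u = dotp (w *m (B - A)) u.
Proof. by move=> uE vB; rewrite mulmxBr dotpBl -vB -dotpBl -uE. Qed.

(** The remainder is tested against itself, which reduces the vector-valued
    expansion to a scalar mean value theorem. *)
Lemma gradient_taylor h x w (L : R) : (forall y, differentiable h y) ->
  (forall v y, differentiable ('D_v h) y) -> 0 <= L ->
  (forall t, 0 < t -> t < 1 ->
     opnorm (hessian h (x + t *: w) - hessian h x) <= L * enorm (t *: w)) ->
  enorm (gradient h (x + w) - gradient h x - w *m hessian h x)
    <= L * enorm w ^+ 2.
Proof.
move=> dh d2h L0 HL.
have [u uE] : exists u,
    u = gradient h (x + w) - gradient h x - w *m hessian h x by eexists.
rewrite -uE.
have [->|u0] := eqVneq u 0; first by rewrite enorm0 mulr_ge0// sqr_ge0.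
have up := enorm_gt0 u0.
have [t [t0 t1 Ht]] := mean_value x w (d2h u).
have E : dotp u u = dotp (w *m (hessian h (x + t *: w) - hessian h x)) u.
  have Hu : 'D_u h (x + w) - 'D_u h x
      = dotp (w *m hessian h (x + t *: w)) u.
    by rewrite Ht; exact: derive2_hessian.
  rewrite !derive_dotp_gradient// -dotpBr dotpC in Hu.
  exact: residual_dotp uE Hu.
rewrite -(ler_pM2r up) -[leLHS]expr2 (enorm_sqr u) E.
apply: (le_trans (dotp_le _ _)); rewrite ler_pM2r//.
apply: (le_trans (enorm_mulmx_le _ _)).
apply: (le_trans (ler_wpM2r (enorm_ge0 _) (HL t t0 t1))).
rewrite enormZ gtr0_norm// -mulrA ler_wpM2l// expr2 -mulrA.
by rewrite ler_piMl ?mulr_ge0 ?enorm_ge0// ltW.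
Qed.

End Calculus.

(** * Distance to a compact set and the variational principle *)

Section Distance.
Context {R : realType} {n : nat}.
Implicit Types (A : set 'rV[R]_n) (x y z p q : 'rV[R]_n).

(** Real-valued, hence meaningful only when [edist_set] is finite ([sdistP]). *)
Definition sdist x A : R := fine (edist_set x A).

Lemma exists_projection x A : compact A -> A !=set0 ->
  exists p, [/\ A p, edist_set x A = (enorm (x - p))%:E &
    forall q, A q -> enorm (x - p) <= enorm (x - q)].
Proof.
move=> cA A0.
have [|p Ap pm] := compact_min _ cA A0 (f := fun y => enorm (x - y)).
  apply: (@lipschitz_enorm_continuous _ _ _ 1) => y z; rewrite mul1r.
  apply: (le_trans (enorm_dist _ _)).
  by rewrite opprB addrC addrA subrK enormC.
exists p; split=> //; apply/eqP; rewrite eq_le; apply/andP; split.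
  by apply: ereal_inf_lbound; exists p.
by apply: le_ereal_inf_tmp => _ [q Aq <-]; rewrite lee_fin pm.
Qed.

Lemma sdistP x A : compact A -> A !=set0 ->
  exists p, [/\ A p, sdist x A = enorm (x - p) & edist_set x A = (sdist x A)%:E].
Proof.
move=> cA A0; have [p [Ap xp _]] := exists_projection x cA A0.
by exists p; rewrite /sdist xp.
Qed.

Lemma sdist_le x A q : compact A -> A q -> sdist x A <= enorm (x - q).
Proof.
move=> cA Aq; have A0 : A !=set0 by exists q.
by have [p [Ap xp /(_ _ Aq)]] := exists_projection x cA A0; rewrite /sdist xp.
Qed.

Lemma sdist_ge0 x A : compact A -> A !=set0 -> 0 <= sdist x A.
Proof. by move=> cA A0; have [p [_ -> _]] := sdistP x cA A0; exact: enorm_ge0. Qed.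

Lemma sdist_mem x A : compact A -> A x -> sdist x A = 0.
Proof.
move=> cA Ax; apply/eqP; rewrite eq_le sdist_ge0//; last by exists x.
by have := sdist_le x cA Ax; rewrite subrr enorm0 => ->.
Qed.

Lemma sdist_triangle x y A : compact A -> A !=set0 ->
  sdist x A <= enorm (x - y) + sdist y A.
Proof.
move=> cA A0; have [p [Ap -> _]] := sdistP y cA A0.
exact: le_trans (sdist_le x cA Ap) (enormB_triangle _ _ _).
Qed.

Lemma sdist_continuous A : compact A -> A !=set0 -> continuous (sdist ^~ A).
Proof.
move=> cA A0; apply: (@lipschitz_enorm_continuous _ _ _ 1) => x y; rewrite mul1r.
rewrite ler_norml; have := sdist_triangle x y cA A0.
by have := sdist_triangle y x cA A0; rewrite (enormC y x); lra.
Qed.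

(** Ekeland's principle. In finite dimension the perturbed function
    [phi + c |. - x|] attains its minimum, since it exceeds its value at [x]
    outside of a compact ball. *)
Lemma ekeland (phi : 'rV[R]_n -> R) x c :
  continuous phi -> (forall y, 0 <= phi y) -> 0 < c ->
  exists y, c * enorm (y - x) <= phi x - phi y /\
    forall z, phi y <= phi z + c * enorm (z - y).
Proof.
move=> phic phi0 c0.
have dc : continuous (fun y => c * enorm (y - x)).
  apply: (@lipschitz_enorm_continuous _ _ _ c) => y z.
  rewrite -mulrBr normrM gtr0_norm// ler_pM2l//.
  apply: (le_trans (enorm_dist _ _)).
  by rewrite opprB addrA subrK.
pose psi y := phi y + c * enorm (y - x).
have psic : continuous psi.
  by move=> y; exact: (continuousD (phic y) (dc y)).
pose K := [set y | c * enorm (y - x) <= phi x].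
have cK : compact K.
  apply: (@closed_enorm_compact _ _ _ (phi x / c + enorm x)).
    exact: closed_le_continuous.
  move=> y; rewrite /K /= mulrC -ler_pdivlMr// => Ky.
  by have := enormD (y - x) x; rewrite subrK; lra.
have Kx : K x by rewrite /K /= subrr enorm0 mulr0.
have [y Ky ym] := compact_min psic cK (ex_intro _ x Kx).
have psiyx : psi y <= phi x.
  by have := ym x Kx; rewrite {2}/psi subrr enorm0 mulr0 addr0.
exists y; split; first by move: psiyx; rewrite /psi; lra.
move=> z.
have tri : c * enorm (z - x) <= c * enorm (z - y) + c * enorm (y - x).
  by rewrite -mulrDr ler_pM2l// enormB_triangle.
have : psi y <= psi z.
  have [/ym//|] := leP (c * enorm (z - x)) (phi x).
  by have := phi0 z; rewrite {2}/psi; lra.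
by rewrite /psi; lra.
Qed.

End Distance.

(** * Mountain pass *)

Section MountainPass.
Context {R : realType} {n : nat}.
Implicit Types (h phi : 'rV[R]_n -> R) (a b x y z v w : 'rV[R]_n) (c r t : R).

Lemma continuous_on_line phi y v :
  continuous phi -> continuous (fun t : R => phi (y + t *: v)).
Proof.
move=> phic t.
have lc : {for t, continuous (fun t : R => y + t *: v)}.
  by apply: cvgD; [exact: cvg_cst|apply: cvgZr_tmp; exact: cvg_id].
exact: (continuous_comp lc (phic _)).
Qed.

Lemma segment_crossing phi y z r : continuous phi -> phi y < r -> r <= phi z ->
  exists t, [/\ 0 <= t, t <= 1 & phi (y + t *: (z - y)) = r].
Proof.
move=> phic yr rz.
have [||t] := @IVT R (fun t : R => phi (y + t *: (z - y))) 0 1 r ler01.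
- by apply: continuous_subspaceT; exact: continuous_on_line.
- rewrite scale0r addr0 scale1r addrC subrK ge_min le_max (ltW yr) rz.
  by rewrite orbT.
- by rewrite in_itv /= => /andP[t0 t1 tr]; exists t.
Qed.

Lemma segment_max h y z : continuous h ->
  exists2 M, forall t, 0 <= t -> t <= 1 -> h (y + t *: (z - y)) <= M &
    exists t, [/\ 0 <= t, t <= 1 & h (y + t *: (z - y)) = M].
Proof.
move=> hc.
have [|t] := @EVT_max R (fun t : R => h (y + t *: (z - y))) 0 1 ler01.
  by apply: continuous_subspaceT; exact: continuous_on_line.
rewrite in_itv /= => /andP[t0 t1] tm; exists (h (y + t *: (z - y))).
  by move=> s s0 s1; apply: tm; rewrite in_itv /= s0.
by exists t.
Qed.

Lemma segment_in_ball x y z r t : 0 <= t -> t <= 1 ->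
  enorm (y - x) < r -> enorm (z - x) < r -> enorm (y + t *: (z - y) - x) < r.
Proof.
move=> t0 t1 yr zr.
have -> : y + t *: (z - y) - x = (1 - t) *: (y - x) + t *: (z - x).
  apply/rowP => i; rewrite !mxE; ring.
apply: (le_lt_trans (enormD _ _)); rewrite !enormZ !ger0_norm ?subr_ge0//.
have [->|tn0] := eqVneq t 0; first by rewrite mul0r subr0 mul1r addr0.
have tp : 0 < t by rewrite lt0r tn0.
have A : t * enorm (z - x) < t * r by rewrite ltr_pM2l.
have B : (1 - t) * enorm (y - x) <= (1 - t) * r.
  by rewrite ler_wpM2l ?subr_ge0// ltW.
lra.
Qed.

(** Polygonal paths inside [h < c], rather than connected components: [h]
    attains its maximum on such a path, and a convex part of [h < c] is absorbed
    in one step. *)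
Inductive reach h c x : 'rV[R]_n -> Prop :=
| reach_refl : reach h c x x
| reach_step y z : reach h c x y ->
    (forall t, 0 <= t -> t <= 1 -> h (y + t *: (z - y)) < c) -> reach h c x z.

Lemma reach_mono h c c' x y : c <= c' -> reach h c x y -> reach h c' x y.
Proof.
move=> cc'; elim=> [|u z _ IH uz]; first exact: reach_refl.
by apply: (reach_step IH) => t t0 t1; exact: lt_le_trans (uz t t0 t1) cc'.
Qed.

Lemma reach_lt h c x y : h x < c -> reach h c x y -> h y < c.
Proof.
move=> xc; case=> [//|u z _ /(_ 1)].
by rewrite scale1r addrC subrK; apply.
Qed.

(** A polygonal path is compact, so [h] stays away from [c] on it. *)
Lemma reach_open h c x y : continuous h ->
  reach h c x y -> exists2 c', c' < c & reach h c' x y.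
Proof.
move=> hc; elim=> [|u z _ [c' c'c IH] uz].
  by exists (c - 1); [lra|exact: reach_refl].
have [M Mmax [t [t0 t1 tM]]] := segment_max u z hc.
have Mc : M < c by rewrite -tM uz.
exists (Num.max c' ((M + c) / 2)); first by rewrite gt_max c'c; lra.
apply: (reach_step (reach_mono _ IH)); first by rewrite le_max lexx.
by move=> s s0 s1; apply: (le_lt_trans (Mmax s s0 s1)); rewrite lt_max; lra.
Qed.

Lemma reach_exists h x y : continuous h -> exists c, reach h c x y.
Proof.
move=> hc; have [M Mmax _] := segment_max x y hc.
exists (M + 1); apply: (reach_step (reach_refl h (M + 1) x)) => t t0 t1.
by have := Mmax t t0 t1; lra.
Qed.

(** A path from [a] to [b] crosses [phi = r], where [h] exceeds [c] by a fixed
    amount because [h <= c + 1] is compact. *)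
Lemma barrier h phi a b c r : continuous h -> continuous phi ->
  (forall c, compact [set x | h x <= c]) ->
  (forall x, phi x = r -> c < h x) -> phi a < r -> r < phi b ->
  exists2 e, 0 < e & ~ reach h (c + e) a b.
Proof.
move=> hc phic hcomp sep ar rb.
have [e e0 eP] : exists2 e, 0 < e & forall x, phi x = r -> c + e <= h x.
  pose K := [set x | h x <= c + 1] `&`
    ([set x | phi x <= r] `&` [set x | r <= phi x]).
  have cK : compact K.
    apply: (subclosed_compact _ (hcomp (c + 1))); last by move=> x [].
    apply: closedI; first exact: closed_le_continuous.
    by apply: closedI; [exact: closed_le_continuous|exact: closed_ge_continuous].
  have [K0|/set0P K0] := eqVneq K set0.
    exists 1 => // x xr; rewrite leNgt; apply/negP => hx.
    have : K x by split; [exact: ltW|rewrite /= xr lexx].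
    by rewrite K0.
  have [x [_ [/= xr rx]] xm] := compact_min hc cK K0.
  have cx : c < h x by apply: sep; apply/eqP; rewrite eq_le xr.
  exists (Num.min 1 (h x - c)); first by rewrite lt_min ltr01 subr_gt0.
  move=> y yr; have [ym|ym] := leP (h y) (c + 1).
    have : h x <= h y by apply: xm; split=> //=; rewrite yr lexx.
    have : Num.min 1 (h x - c) <= h x - c by rewrite ge_min lexx orbT.
    lra.
  have : Num.min 1 (h x - c) <= 1 by rewrite ge_min lexx.
  lra.
exists e => // ab.
suff : phi b < r by rewrite ltNge (ltW rb).
elim: ab => [//|y z _ yr yz]; rewrite ltNge; apply/negP => rz.
have [t [t0 t1 /eP]] := segment_crossing phic yr rz.
by rewrite leNgt yz.
Qed.

Lemma closure_enormP (U : set 'rV[R]_n) x :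
  closure U x <-> forall e, 0 < e -> exists2 y, U y & enorm (y - x) < e.
Proof.
split=> [Ux e e0|H B /nbhs_enormP[e e0 eB]].
  have /Ux[y [Uy ye]] : nbhs x [set y | enorm (y - x) < e].
    by apply/nbhs_enormP; exists e.
  by exists y.
by have [y Uy ye] := H e e0; exists y; split=> //; exact: eB.
Qed.

Lemma exists_noncollinear v : (2 <= n)%N -> v != 0 ->
  exists w, forall l, w != l *: v.
Proof.
move=> n2 v0.
have [i vi] : exists i, v 0 i != 0.
  apply/existsP; apply: contraNT v0; rewrite negb_exists => /forallP v0.
  by apply/eqP/rowP => i; rewrite mxE; apply/eqP; rewrite -[_ == _]negbK v0.
have [j ji] : exists j, j != i.
  have : (0 < #|predC1 i|)%N by rewrite cardC1 card_ord; case: n n2 => [|[]].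
  by move=> /card_gt0P[j]; rewrite !inE => ji; exists j.
exists (delta_mx 0 j) => l; apply/eqP => /rowP E.
have := E i; rewrite !mxE eqxx /= eq_sym (negbTE ji) => /esym/eqP.
rewrite mulf_eq0 (negbTE vi) orbF => /eqP l0.
by have := E j; rewrite !mxE !eqxx l0 mul0r => /eqP; rewrite oner_eq0.
Qed.

Section LocalStructure.
Variables (h : 'rV[R]_n -> R) (a : 'rV[R]_n) (c : R).
Hypothesis dh : forall x, differentiable h x.
Hypothesis hac : h a < c.

Let U := [set y | reach h c a y].

Let hcont : continuous h.
Proof. by move=> x; exact: differentiable_continuous. Qed.

Let sub_open x : h x < c -> exists2 r, 0 < r &
  forall y, enorm (y - x) < r -> h y < c.
Proof.
move=> xc; have xc0 : 0 < c - h x by rewrite subr_gt0.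
have [r r0 rP] := (continuous_enormP h x).1 (@hcont x) _ xc0.
by exists r => // y /rP; rewrite ltr_norml => /andP[_]; lra.
Qed.

Let step_in_ball x r y z : (forall y, enorm (y - x) < r -> h y < c) ->
  enorm (y - x) < r -> enorm (z - x) < r -> U y -> U z.
Proof.
move=> rc yr zr Uy; apply: (reach_step Uy) => t t0 t1.
exact/rc/(segment_in_ball t0 t1 yr zr).
Qed.

Lemma closure_reach_below x : closure U x -> h x < c ->
  exists2 r, 0 < r & forall y, enorm (y - x) < r -> U y.
Proof.
move=> /closure_enormP Fx /sub_open[r r0 rc]; exists r => // z zr.
by have [y Uy yr] := Fx r r0; exact: (step_in_ball rc yr zr Uy).
Qed.

(** Near a regular point, moving along the negative gradient pushes every point
    of [h <= c] into one common ball inside [h < c]. *)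
Lemma closure_reach_regular x : closure U x -> h x <= c ->
  (forall v, {for x, continuous ('D_v h)}) -> gradient h x != 0 ->
  exists2 r, 0 < r & forall z, enorm (z - x) < r -> h z <= c -> closure U z.
Proof.
move=> /closure_enormP Fx xc Dc g0; set e := - gradient h x.
have ep : 0 < enorm e by rewrite /e enormN enorm_gt0.
have De : 0 < - 'D_e h x.
  rewrite derive_dotp_gradient// dotpNl -enorm_sqr opprK exprn_gt0//.
  exact: enorm_gt0.
have [r1 r10 r1P] := (continuous_enormP _ _).1 (Dc e) _ De.
pose t0 := r1 / 2 / enorm e.
have t00 : 0 < t0 by rewrite !divr_gt0.
have dec y t : enorm (y - x) < r1 / 2 -> 0 < t -> t <= t0 ->
    h (y + t *: e) < h y.
  move=> yr tp tt0; have [s [s0 s1 Hs]] := mean_value y (t *: e) dh.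
  have : 'D_e h (y + s *: (t *: e)) < 0.
    have /r1P : enorm (y + s *: (t *: e) - x) < r1.
      have := enormD (y - x) (s *: (t *: e)).
      have -> : y - x + s *: (t *: e) = y + s *: (t *: e) - x by rewrite addrAC.
      have : enorm (s *: (t *: e)) <= r1 / 2.
        rewrite !enormZ !gtr0_norm//.
        have : t * enorm e <= r1 / 2 by rewrite -ler_pdivlMr.
        have : s * (t * enorm e) <= 1 * (t * enorm e).
          by rewrite ler_wpM2r ?(ltW s1)// mulr_ge0 ?(ltW tp) ?(ltW ep).
        lra.
      lra.
    by rewrite ltr_norml => /andP[_]; lra.
  rewrite derive_dotp_gradient// => D0.
  move: Hs; rewrite derive_dotp_gradient// dotpZl.
  by have := mulr_gt0 tp (_ : 0 < - dotp e (gradient h (y + s *: (t *: e)))); lra.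
have xr1 : enorm (x - x) < r1 / 2 by rewrite subrr enorm0; lra.
have [r2 r20 r2P] : exists2 r, 0 < r &
    forall y, enorm (y - (x + t0 *: e)) < r -> h y < c.
  by apply: sub_open; exact: lt_le_trans (dec x t0 xr1 t00 (lexx _)) xc.
have shift y : y + t0 *: e - (x + t0 *: e) = y - x.
  by rewrite opprD addrACA subrr addr0.
exists (Num.min (r1 / 2) r2); first by rewrite lt_min r20; lra.
move=> z; rewrite lt_min => /andP[zr1 zr2] zc.
have [|y Uy] := Fx (Num.min (r1 / 2) r2); first by rewrite lt_min r20; lra.
rewrite lt_min => /andP[yr1 yr2].
have yc : h y < c by exact: reach_lt Uy.
have Uy' : U (y + t0 *: e).
  apply: (reach_step Uy) => t tge0 tle1.
  rewrite [y + _ - _]addrC addKr scalerA.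
  have [->|tn0] := eqVneq t 0; first by rewrite mul0r scale0r addr0.
  have tp : 0 < t by rewrite lt0r tn0.
  apply: lt_trans yc; apply: dec => //; first by rewrite mulr_gt0.
  by rewrite ler_piMl// ltW.
have Uz' : U (z + t0 *: e).
  by apply: step_in_ball r2P _ _ Uy'; rewrite shift.
apply/closure_enormP => eps eps0.
pose s := Num.min t0 (eps / 2 / enorm e).
have s0 : 0 < s by rewrite lt_min t00 !divr_gt0.
have st0 : s <= t0 by rewrite ge_min lexx.
exists (z + s *: e); last first.
  rewrite [z + _ - _]addrC addKr enormZ gtr0_norm//.
  have : s <= eps / 2 / enorm e by rewrite ge_min lexx orbT.
  by rewrite ler_pdivlMr//; lra.
apply: (reach_step Uz') => t tge0 tle1.
have -> : z + t0 *: e + t *: (z + s *: e - (z + t0 *: e)) =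
    z + (t0 + t * (s - t0)) *: e by apply/rowP => i; rewrite !mxE; ring.
apply: lt_le_trans zc; apply: dec => //; nra.
Qed.

(** A punctured ball is connected in dimension at least two: a segment issued
    from [y] misses the centre unless its end lies on one particular line. *)
Lemma closure_reach_peak x r : (2 <= n)%N -> closure U x -> h x = c -> 0 < r ->
  (forall y, y != x -> enorm (y - x) < r -> h y < h x) ->
  forall z, enorm (z - x) < r -> closure U z.
Proof.
move=> n2 /closure_enormP Fx xc r0 peak z zr.
have [y Uy yr] := Fx r r0.
have yx : y - x != 0.
  rewrite subr_eq0; apply/eqP => yx.
  by have := reach_lt hac Uy; rewrite yx xc ltxx.
have reach_off u : enorm (u - x) < r -> (forall l, u - x != l *: (y - x)) -> U u.
  move=> ur ul; apply: (reach_step Uy) => t t0 t1.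
  rewrite -xc; apply: peak; last exact: segment_in_ball.
  apply/eqP => E.
  have {}E : t *: (u - x) = (t - 1) *: (y - x).
    apply/rowP => i; have /rowP/(_ i) := E; rewrite !mxE => E'.
    by rewrite -{1}E' -E'; ring.
  have [t00|tn0] := eqVneq t 0.
    move: E; rewrite t00 scale0r sub0r scaleN1r => /esym/eqP.
    by rewrite oppr_eq0 (negbTE yx).
  have := ul (t^-1 * (t - 1)); rewrite -scalerA -E scalerA mulVf// scale1r.
  by rewrite eqxx.
have [[l zl]|zl] := pselect (exists l, z - x = l *: (y - x)); last first.
  apply: subset_closure; apply: reach_off => // l; apply/eqP => zl'.
  by apply: zl; exists l.
have [w wP] := exists_noncollinear n2 yx.
have wp : 0 < enorm w.
  by apply: enorm_gt0; have := wP 0; rewrite scale0r.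
apply/closure_enormP => eps eps0.
pose s := Num.min eps (r - enorm (z - x)) / 2 / enorm w.
have m0 : 0 < Num.min eps (r - enorm (z - x)) by rewrite lt_min eps0 subr_gt0.
have s0 : 0 < s by rewrite !divr_gt0.
have sw : enorm (s *: w) < Num.min eps (r - enorm (z - x)).
  by rewrite enormZ gtr0_norm// /s divfK ?gt_eqF//; lra.
have [sw1 sw2] : enorm (s *: w) < eps /\ enorm (s *: w) < r - enorm (z - x).
  by move: sw; rewrite lt_min => /andP[].
exists (z + s *: w); last by rewrite [z + _ - _]addrC addKr.
apply: reach_off.
  by have := enormD (z - x) (s *: w); rewrite addrAC; lra.
move=> k; apply/eqP; rewrite addrAC zl => E.
have := wP (s^-1 * (k - l)); rewrite -scalerA scalerBl -E addrAC subrr add0r.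
by rewrite scalerA mulVf ?gt_eqF// scale1r eqxx.
Qed.

End LocalStructure.

(** Connectedness of the set of global minimizers, in the form of an
    intermediate value property. Otherwise let [c] be the supremum of the levels
    at which no path inside the sublevel set joins [a] to [b]. The closure of
    the part of [h < c] reachable from [a] is then a compact, relatively open
    part of [h <= c] that avoids [b], so that a barrier at a higher level
    exists. *)
Theorem mountain_pass h phi a b m r : (2 <= n)%N ->
  (forall x, differentiable h x) -> (forall v, continuous ('D_v h)) ->
  (forall c, compact [set x | h x <= c]) ->
  (forall x, gradient h x = 0 -> local_minima h x \/
     exists2 e, 0 < e & forall y, y != x -> enorm (y - x) < e -> h y < h x) ->
  continuous phi -> (forall x, m <= h x) -> h a = m -> h b = m ->
  phi a < r -> r < phi b -> exists2 p, h p = m & phi p = r.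
Proof.
move=> n2 dh Dc hcomp crit phic mmin ha hb ar rb.
have hc : continuous h by move=> x; exact: differentiable_continuous.
apply: contrapT => nop.
have [e0 e00 ne0] : exists2 e, 0 < e & ~ reach h (m + e) a b.
  apply: (barrier hc phic hcomp) ar rb => x xr.
  rewrite lt_neqAle mmin andbT; apply/eqP => mx; apply: nop.
  by exists x.
pose D := [set c | ~ reach h c a b].
have [c1 c1P] := reach_exists a b hc.
have Dub : ubound D c1.
  move=> d Dd; rewrite leNgt; apply/negP => dc1; apply: Dd.
  exact: reach_mono (ltW dc1) c1P.
have Dsup : has_sup D by split; [exists (m + e0)|exists c1].
pose c := sup D.
have mc : m < c.
  by have : m + e0 <= c; [apply: ub_le_sup; [exact: (proj2 Dsup)|exact: ne0]|lra].
have ncab : ~ reach h c a b.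
  move=> /(reach_open hc)[c' c'c rc'].
  have c'0 : 0 < c - c' by rewrite subr_gt0.
  have [d Dd] := sup_adherent c'0 Dsup; rewrite -/c subKr => /ltW c'd.
  by apply: Dd; exact: reach_mono rc'.
have hac : h a < c by rewrite ha.
pose F := closure [set y | reach h c a y].
have Fa : F a by apply: subset_closure; exact: reach_refl.
have Fc : F `<=` [set x | h x <= c].
  rewrite /F closureE; apply: smallest_sub; first exact: closed_le_continuous.
  by move=> x Ux; exact: ltW (reach_lt hac Ux).
have cF : compact F.
  by apply: (subclosed_compact _ (hcomp c) Fc); exact: closed_closure.
have F0 : F !=set0 by exists a.
have nFb : ~ F b.
  move=> Fb; have [|s s0 sP] := closure_reach_below dh Fb; first by rewrite hb.
  by apply: ncab; apply: sP; rewrite subrr enorm0.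
have Fopen x : F x ->
    exists2 s, 0 < s & forall y, enorm (y - x) < s -> h y <= c -> F y.
  move=> Fx; have [xc|] := ltP (h x) c.
    have [s s0 sP] := closure_reach_below dh Fx xc; exists s => // y ys _.
    by apply: subset_closure; exact: sP.
  move=> cx; have xc : h x = c by apply/eqP; rewrite eq_le cx Fc.
  have [g0|g0] := eqVneq (gradient h x) 0; last first.
    by apply: closure_reach_regular => //; rewrite ?xc// => v; exact: Dc.
  have [xmin|[s s0 sP]] := crit x g0; last first.
    exists s => // y ys _.
    exact: closure_reach_peak n2 Fx xc s0 sP _ ys.
  move: xmin => /nbhs_enormP[s s0 sP].
  have [y Uy ys] := (closure_enormP _ _).1 Fx s s0.
  by have := sP y ys; rewrite xc leNgt (reach_lt hac Uy).
(* [G] is open and meets [h <= c] exactly in [F], so that the part of [h <= c]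
   outside of [F] is compact as well. *)
pose G := interior [set y | h y <= c -> F y].
have FG x : F x -> G x.
  by move=> /Fopen[s s0 sP]; apply/nbhs_enormP; exists s.
pose Z := [set x | h x <= c] `&` ~` G.
have cZ : compact Z.
  apply: (subclosed_compact _ (hcomp c)); last by move=> x [].
  apply: closedI; first exact: closed_le_continuous.
  by apply: open_closedC; exact: open_interior.
have Zb : Z b.
  split; first by rewrite /= hb ltW.
  by move=> /interior_subset bF; apply: nFb; apply: bF; rewrite hb ltW.
pose psi x := sdist x F.
have psic : continuous psi by exact: sdist_continuous.
have [z Zz zm] := compact_min psic cZ (ex_intro _ b Zb).
have pz : 0 < psi z.
  have [p [Fp Ep _]] := sdistP z cF F0.
  rewrite /psi Ep enorm_gt0// subr_eq0; apply/eqP => zp.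
  by case: Zz => _; apply; apply: FG; rewrite zp.
have [e ep ne] : exists2 e, 0 < e & ~ reach h (c + e) a b.
  apply: (@barrier h psi a b c (psi z / 2)) => //.
  - move=> x xz; rewrite ltNge; apply/negP => xc.
    have [Gx|nGx] := pselect (G x).
      have Fx : F x by exact: interior_subset Gx xc.
      by move: xz; rewrite /psi (sdist_mem cF Fx) -/(psi z); lra.
    by have := zm x (conj xc nGx); lra.
  - by rewrite /psi (sdist_mem cF Fa) -/(psi z); lra.
  - by have := zm b Zb; lra.
have : c + e <= c by apply: ub_le_sup; [exact: (proj2 Dsup)|exact: ne].
lra.
Qed.

End MountainPass.

(** * Nondegenerate local maxima *)

Section NegativeDefinite.
Context {R : realType} {n : nat}.
Implicit Types (h : 'rV[R]_n -> R) (x y v w : 'rV[R]_n).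

Lemma continuous_sum (I : finType) (F : I -> 'rV[R]_n -> R) :
  (forall i, continuous (F i)) -> continuous (fun x => \sum_i F i x).
Proof.
move=> Fc; apply: (@continuous_big _ _ _ _ xpredT) => //.
exact: add_continuous.
Qed.

Lemma continuous_dist (f : 'rV[R]_n -> R) a :
  continuous f -> continuous (fun x => `|f x - a|).
Proof.
move=> fc x; have fa := continuousB (fc x) (@cst_continuous _ _ a x).
exact: (continuous_comp fa (@norm_continuous _ _ _)).
Qed.

Lemma quadratic_form_continuous (A : 'M[R]_n) :
  continuous (fun w : 'rV[R]_n => dotp (w *m A) w).
Proof.
apply: continuous_sum => i w.
have coordc j : continuous (fun w : 'rV[R]_n => w 0 j) by exact: coord_continuous.
have mc : continuous (fun w : 'rV[R]_n => (w *m A) 0 i).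
  have -> : (fun w : 'rV[R]_n => (w *m A) 0 i) = (fun w => \sum_j w 0 j * A j i).
    by apply/funext => u; rewrite mxE.
  apply: continuous_sum => j u.
  exact: (continuousM (coordc j u) (@cst_continuous _ _ (A j i) u)).
exact: (continuousM (mc w) (coordc i w)).
Qed.

Lemma quadratic_form_le (A : 'M[R]_n) w :
  dotp (w *m A) w <= (\sum_i \sum_j `|A j i|) * enorm w ^+ 2.
Proof.
rewrite mulr_suml; apply: ler_sum => i _; rewrite mxE !mulr_suml.
apply: ler_sum => j _; apply: (le_trans (ler_norm _)).
rewrite !normrM (mulrC `|w 0 j|) -mulrA ler_wpM2l// expr2.
by rewrite ler_pM// coord_le_enorm.
Qed.

(** On the compact unit sphere the quadratic form of the Hessian at [x] is at
    most some [- l < 0], so that by continuity the Hessian is still negative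
    definite near [x]; two mean value theorems conclude. *)
Lemma negative_definite_peak h x : (0 < n)%N -> Ck_on 2 setT h ->
  gradient h x = 0 -> negative_definite (hessian h x) ->
  exists2 e, 0 < e & forall y, y != x -> enorm (y - x) < e -> h y < h x.
Proof.
move=> n0 [dh0 C2] g0 neg.
have dh y : differentiable h y by exact: dh0.
have d2h v y : differentiable ('D_v h) y by exact: (C2 v).1.
have hess_c i j : continuous (fun y => hessian h y i j).
  move=> y; have -> : (fun y => hessian h y i j) =
      'D_(delta_mx 0 i) ('D_(delta_mx 0 j) h) by apply/funext => z; rewrite mxE.
  exact: (C2 _).2.
pose K := [set w : 'rV[R]_n | enorm w <= 1] `&` [set w : 'rV[R]_n | 1 <= enorm w].
have cK : compact K.
  apply: (@closed_enorm_compact _ _ _ 1); last by move=> w [].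
  apply: closedI; first exact: (closed_le_continuous enorm_continuous).
  exact: (closed_ge_continuous enorm_continuous).
have normK w : w != 0 -> K ((enorm w)^-1 *: w).
  move=> /enorm_gt0 w0; split => /=;
  by rewrite enormZ ger0_norm ?invr_ge0 ?enorm_ge0// mulVf ?gt_eqF.
have K0 : K !=set0.
  pose i := Ordinal n0; exists ((enorm (delta_mx 0 i))^-1 *: delta_mx 0 i).
  apply: normK; apply/eqP => /rowP/(_ i); rewrite !mxE !eqxx => /eqP.
  by rewrite oner_eq0.
pose q y w := dotp (w *m hessian h y) w.
have qc : continuous (fun w => - q x w).
  by move=> w; exact: (continuousN (@quadratic_form_continuous (hessian h x) w)).
have [w0 [_ /= w01] w0m] := compact_min qc cK K0.
have w0n0 : w0 != 0.
  by apply/eqP => w00; move: w01; rewrite w00 enorm0 ler10.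
pose l := - q x w0.
have l0 : 0 < l.
  have := neg _ w0n0; rewrite /l /q oppr_gt0 => H; apply: le_lt_trans H.
  by rewrite mxE le_eqVlt; apply/orP; left; apply/eqP/eq_bigr => i _; rewrite !mxE.
have qx w : q x w <= - l * enorm w ^+ 2.
  have [->|wn0] := eqVneq w 0.
    by rewrite enorm0 expr0n mulr0 /q mul0mx /dotp big1// => i _; rewrite !mxE mul0r.
  have wp := enorm_gt0 wn0.
  have := w0m _ (normK w wn0).
  rewrite /= -/l /q -scalemxAl dotpZl dotpZr mulrA -expr2 => H.
  have : l <= - (q x w) / enorm w ^+ 2.
    by apply: (le_trans H); rewrite /q exprVn mulNr (mulrC _^-1).
  by rewrite ler_pdivlMr ?exprn_gt0// mulNr lerNr /l !opprK.
pose E y := \sum_i \sum_j `|hessian h y j i - hessian h x j i|.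
have Ec : continuous E.
  apply: continuous_sum => i; apply: continuous_sum => j.
  exact: continuous_dist (hess_c j i).
have [e e0 eP] := (continuous_enormP E x).1 (Ec x) _ l0.
have Ex : E x = 0.
  by rewrite /E big1// => i _; rewrite big1// => j _; rewrite subrr normr0.
have qneg y w : w != 0 -> enorm (y - x) < e -> q y w < 0.
  move=> /enorm_gt0 wp /eP; rewrite Ex subr0 => El.
  have : q y w - q x w <= E y * enorm w ^+ 2.
    rewrite /q -dotpBl -mulmxBr; apply: (le_trans (quadratic_form_le _ _)).
    rewrite le_eqVlt; apply/orP; left; apply/eqP; congr (_ * _).
    apply: eq_bigr => i _; apply: eq_bigr => j _.
    by rewrite [in LHS]mxE [in X in _ + X]mxE.
  have : E y * enorm w ^+ 2 < l * enorm w ^+ 2.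
    by rewrite ltr_pM2r ?exprn_gt0// (le_lt_trans (ler_norm _) El).
  move: (qx w); rewrite mulNr.
  by move: (q y w) (q x w) (E y * _) (l * _) => s t u v; lra.
exists e => // y yx ye.
have w0' : y - x != 0 by rewrite subr_eq0.
have [t [t0 t1 Ht]] := mean_value x (y - x) dh.
rewrite [x + (y - x)]addrC subrK in Ht.
have [s [s0 s1 Hs]] := mean_value x (t *: (y - x)) (d2h (y - x)).
have Dx0 : 'D_(y - x) h x = 0.
  rewrite derive_dotp_gradient// g0 /dotp big1// => i _.
  by rewrite [X in _ * X]mxE mulr0.
move: Hs; rewrite Dx0 subr0 -Ht derive_dotp_gradient// dotpZl.
rewrite -derive_dotp_gradient// derive2_hessian// => Hs.
rewrite -subr_lt0 Hs pmulr_rlt0// qneg// [x + _]addrC addrK !enormZ !gtr0_norm//.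
apply: le_lt_trans ye; rewrite mulrA ler_piMl ?enorm_ge0//.
by rewrite mulr_ile1// ltW.
Qed.

End NegativeDefinite.

(** * Error bounds *)

Section ErrorBounds.
Context {R : realType} {n : nat}.
Implicit Types (h : 'rV[R]_n -> R) (x y z p q w : 'rV[R]_n).

(** By the variational principle a point of a sublevel set lies at bounded
    distance from a point where the gradient has norm at most one, and such
    points are bounded by the error bound at infinity. *)
Lemma error_bound_compact_sublevel h (D nu : R) x0 c :
  (forall x, differentiable h x) -> (forall y, h x0 <= h y) -> compact (argmin h) ->
  0 < nu ->
  (forall x, D <= enorm x -> nu * sdist x (argmin h) <= enorm (gradient h x)) ->
  compact [set x | h x <= c].
Proof.
move=> dh hx0 cS nu0 EB.
have hc : continuous h by move=> x; exact: differentiable_continuous.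
have [rS _ rSP] := compact_enorm_bounded cS.
have S0 : argmin h !=set0 by exists x0.
apply: (@closed_enorm_compact _ _ _ (`|D| + (nu^-1 + rS) + (c - h x0))).
  exact: closed_le_continuous.
move=> x /= xc.
have [||y []] := @ekeland _ _ (fun y => h y - h x0) x 1 _ _ ltr01.
- by move=> y; exact: (continuousB (hc y) (@cst_continuous _ _ (h x0) y)).
- by move=> y; rewrite subr_ge0.
rewrite mul1r => yx ymin.
have g1 : enorm (gradient h y) <= 1.
  by apply: slope_gradient_le => // z; have := ymin z; lra.
have yb : enorm y <= `|D| + (nu^-1 + rS).
  have rS0 : 0 <= rS by exact: le_trans (enorm_ge0 _) (rSP x0 hx0).
  have nV : 0 < nu^-1 by rewrite invr_gt0.
  have [/EB yD|/ltW yD] := leP D (enorm y); last first.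
    by have := ler_norm D; lra.
  have [p [Sp Ep _]] := sdistP y cS S0.
  have : enorm (y - p) <= nu^-1.
    by rewrite -Ep -[leRHS]mulr1 ler_pdivlMl//; lra.
  have := enormD (y - p) p; rewrite subrK; have := rSP p Sp; have := normr_ge0 D.
  lra.
have := enormD (x - y) y; rewrite subrK (enormC x); have := hx0 y; lra.
Qed.

Lemma sqr_le_of_le (u v d : R) : 0 <= u -> 0 <= v -> 0 <= d -> u <= v + d ->
  u ^+ 2 <= v ^+ 2 + 2 * u * d.
Proof.
move=> u0 v0 d0 uvd; have [uv|/ltW vu] := leP u v.
  have : u ^+ 2 <= v ^+ 2 by rewrite ler_pXn2r.
  by have : 0 <= u * d by [rewrite mulr_ge0]; lra.
have : (u - v) * (u + v) <= d * (2 * u) by apply: ler_pM; lra.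
by rewrite !expr2; lra.
Qed.

(** The PL inequality bounds the slope of [sqrt (h - m)] from below, so that the
    variational principle applied to this function can only stop at a
    minimizer; the factor [3 / 4] is the slack given to the principle. *)
Lemma PL_local_error_bound h (mu m : R) (N : set 'rV[R]_n) p : 0 < mu ->
  (forall x, differentiable h x) -> (forall x, m <= h x) -> h p = m -> nbhs p N ->
  (forall x, N x -> h x - m <= (2 * mu)^-1 * enorm (gradient h x) ^+ 2) ->
  exists2 e, 0 < e & forall x, enorm (x - p) < e ->
    exists2 q, h q = m & 3 / 4 * mu * enorm (x - q) <= enorm (gradient h x).
Proof.
move=> mu0 dh hm hp /nbhs_enormP[r r0 rN] PL.
have hc : continuous h by move=> x; exact: differentiable_continuous.
pose phi x := Num.sqrt (h x - m).
have phiE x : phi x ^+ 2 = h x - m by rewrite sqr_sqrtr// subr_ge0.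
have phi0 x : 0 <= phi x by exact: sqrtr_ge0.
have phic : continuous phi.
  move=> x; apply: (@continuous_comp _ _ _ (fun x => h x - m) Num.sqrt).
    exact: (continuousB (hc x) (@cst_continuous _ _ m x)).
  exact: sqrt_continuous.
have phip : phi p = 0 by rewrite /phi hp subrr sqrtr0.
have PL' x : N x -> 2 * mu * phi x ^+ 2 <= enorm (gradient h x) ^+ 2.
  by move=> /PL; rewrite phiE ler_pdivlMl// mulr_gt0.
(* By PL the slope of [phi] is at least [Num.sqrt (mu / 2)] off the minimizers. *)
pose c := 3 / 4 * Num.sqrt (mu / 2).
have sq : Num.sqrt (mu / 2) ^+ 2 = mu / 2 by rewrite sqr_sqrtr//; lra.
have c2 : c ^+ 2 = 9 / 32 * mu by rewrite exprMn sq; lra.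
have c0 : 0 < c by rewrite mulr_gt0 ?sqrtr_gt0; lra.
have r20 : 0 < r / 2 by lra.
have [e1 e10 e1P] := (continuous_enormP phi p).1 (phic p) _ (mulr_gt0 c0 r20).
exists (Num.min e1 (r / 2)); first by rewrite lt_min e10; lra.
move=> x; rewrite lt_min => /andP[/e1P xe1 xr].
have {}xe1 : phi x < c * (r / 2) by move: xe1; rewrite phip subr0 ger0_norm.
have Nx : N x by apply: rN; lra.
have [y [yx ymin]] := ekeland x phic phi0 c0.
have yxr : enorm (y - x) < r / 2.
  by rewrite -(ltr_pM2l c0); have := phi0 y; lra.
have Ny : N y.
  by apply: rN; have := enormB_triangle y x p; lra.
have phiy : phi y = 0.
  apply/eqP; rewrite -[_ == 0]negbK; apply/negP => yn0.
  have py : 0 < phi y by rewrite lt0r yn0 phi0.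
  have gy : enorm (gradient h y) <= 2 * c * phi y.
    apply: slope_gradient_le => // [|z]; first by rewrite !mulr_ge0// ltW.
    have -> : 2 * c * phi y * enorm (z - y) = 2 * phi y * (c * enorm (z - y)).
      by ring.
    have d0 : 0 <= c * enorm (z - y) by rewrite mulr_ge0 ?enorm_ge0// ltW.
    have : phi y ^+ 2 <= phi z ^+ 2 + 2 * phi y * (c * enorm (z - y)).
      exact: sqr_le_of_le (ltW py) (phi0 z) d0 (ymin z).
    by rewrite !phiE; lra.
  have : enorm (gradient h y) ^+ 2 <= (2 * c * phi y) ^+ 2.
    by rewrite ler_pXn2r ?nnegrE ?enorm_ge0// !mulr_ge0// ltW.
  rewrite 2!exprMn c2; have := PL' y Ny.
  have : 0 < mu * phi y ^+ 2 by rewrite mulr_gt0 ?exprn_gt0.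
  lra.
exists y; first by have := phiE y; rewrite phiy expr0n /=; lra.
rewrite -(ler_pXn2r (n := 2)) ?nnegrE ?enorm_ge0// ?mulr_ge0 ?enorm_ge0//; try lra.
apply: le_trans (PL' x Nx).
have : (c * enorm (x - y)) ^+ 2 <= phi x ^+ 2.
  rewrite ler_pXn2r ?nnegrE ?mulr_ge0 ?enorm_ge0 ?(ltW c0)// enormC.
  by move: yx; rewrite phiy subr0.
rewrite exprMn c2 !exprMn => H.
have : 2 * mu * (9 / 32 * mu * enorm (x - y) ^+ 2) <= 2 * mu * phi x ^+ 2.
  by rewrite ler_pM2l//; lra.
by apply: le_trans; rewrite le_eqVlt; apply/orP; left; apply/eqP; field.
Qed.

(** The local error bound, applied arbitrarily close to [S] on the segment from
    [x] to its projection [p], bounds the Hessian at [p] from below in the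
    direction [x - p]; a Lipschitz Hessian then carries this estimate back to
    [x], on a neighborhood whose size depends only on the constants. Each of the
    two Taylor remainders costs at most [mu / 8] when [sdist x S] is at most
    [mu / (8 * L)], which leaves [mu / 2] of the initial [3 / 4 * mu]. *)
Lemma uniform_error_bound h (mu L r3 : R) (S : set 'rV[R]_n) x :
  0 < mu -> 0 < L ->
  (forall x, differentiable h x) -> (forall v x, differentiable ('D_v h) x) ->
  compact S -> S !=set0 -> (forall p, S p -> gradient h p = 0) ->
  (forall p, S p -> exists2 e, 0 < e & forall x, enorm (x - p) < e ->
    exists2 q, S q & 3 / 4 * mu * enorm (x - q) <= enorm (gradient h x)) ->
  (forall x y, sdist x S <= r3 -> sdist y S <= r3 ->
    opnorm (hessian h x - hessian h y) <= L * enorm (x - y)) ->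
  sdist x S <= r3 -> sdist x S <= mu / (8 * L) ->
  mu / 2 * sdist x S <= enorm (gradient h x).
Proof.
move=> mu0 L0 dh d2h cS S0 gS locEB HL xr3 xL.
have [p [Sp Ep _]] := sdistP x cS S0.
set w := x - p in Ep; have xE : x = p + w by rewrite /w addrC subrK.
have [wn0|wn0] := eqVneq w 0.
  by rewrite Ep wn0 enorm0 mulr0 enorm_ge0.
have wp := enorm_gt0 wn0.
have pr3 : sdist p S <= r3.
  by rewrite (sdist_mem cS Sp) (le_trans _ xr3)// sdist_ge0.
have taylor t : 0 < t -> t <= 1 ->
    enorm (gradient h (p + t *: w) - t *: (w *m hessian h p))
      <= L * (t * enorm w) ^+ 2.
  move=> t0 t1; have -> : t * enorm w = enorm (t *: w).
    by rewrite enormZ gtr0_norm.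
  rewrite scalemxAl -[gradient h (p + _)]subr0 -(gS p Sp).
  apply: gradient_taylor => //; first exact: ltW.
  move=> s s0 s1; have -> : s *: (t *: w) = p + s *: (t *: w) - p.
    by rewrite addrC addKr.
  rewrite [_ + (_ - p)]addrC subrK; apply: HL => //.
  apply: le_trans (sdist_le _ cS Sp) _.
  rewrite addrC addKr !enormZ !gtr0_norm// (le_trans _ xr3)// Ep mulrA.
  by rewrite ler_piMl ?enorm_ge0// mulr_ile1// ltW.
have [e e0 eP] := locEB p Sp.
pose s := Num.min 1 (e / 2 / enorm w).
have s0 : 0 < s by rewrite lt_min ltr01 !divr_gt0.
have s1 : s <= 1 by rewrite ge_min lexx.
have se : s * enorm w < e.
  have : s <= e / 2 / enorm w by rewrite ge_min lexx orbT.
  by rewrite ler_pdivlMr//; lra.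
have [|q Sq qEB] := eP (p + s *: w).
  by rewrite addrC addKr enormZ gtr0_norm.
have far : s * enorm w <= enorm (p + s *: w - q).
  have := enormD (p + s *: w - q) ((1 - s) *: w).
  have -> : p + s *: w - q + (1 - s) *: w = x - q.
    by rewrite xE; apply/rowP => i; rewrite !mxE; ring.
  rewrite enormZ ger0_norm ?subr_ge0//.
  by have := sdist_le x cS Sq; rewrite Ep mulrBl mul1r; lra.
have Hp : 3 / 4 * mu * enorm w - L * enorm w ^+ 2 <= enorm (w *m hessian h p).
  have := taylor s s0 s1; set u := gradient h _ => Tu.
  have := enormD (u - s *: (w *m hessian h p)) (s *: (w *m hessian h p)).
  rewrite subrK [enorm (s *: (w *m _))]enormZ gtr0_norm// => Hu.
  have far' : 3 / 4 * mu * (s * enorm w) <= enorm u.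
    by apply: le_trans qEB; rewrite ler_pM2l//; lra.
  have ss : L * (s * enorm w) ^+ 2 <= s * (L * enorm w ^+ 2).
    rewrite exprMn mulrCA (ler_wpM2r (mulr_ge0 (ltW L0) (sqr_ge0 _)))//.
    by rewrite expr2 ler_piMl// ltW.
  rewrite -(ler_pM2l s0); lra.
have := taylor 1 ltr01 (lexx _); rewrite !scale1r mul1r -xE => T1.
have := enormD (gradient h x) (w *m hessian h p - gradient h x).
rewrite addrC subrK (enormC (w *m _)) => Hx.
have : L * enorm w ^+ 2 <= mu / 8 * enorm w.
  rewrite expr2 mulrA ler_wpM2r ?enorm_ge0// mulrC -ler_pdivlMr//.
  by rewrite -Ep (le_trans xL)// invfM mulrA.
rewrite Ep; lra.
Qed.

End ErrorBounds.

(** * Functions satisfying the PL condition *)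

Section PLoConsequences.
Context {R : realType} {n : nat}.
Variables (mu : R) (h : 'rV[R]_n -> R).
Hypothesis PLh : PLo mu h.

Lemma PLo_gt0 : 0 < mu.
Proof. by have [N [[_ [mu0]]]] := PLh. Qed.

Lemma PLo_C2 : Ck_on 2 setT h.
Proof. by have [N [[]]] := PLh. Qed.

Lemma PLo_differentiable x : differentiable h x.
Proof. by have [dh _] := PLo_C2; exact: dh. Qed.

Lemma PLo_derive_differentiable v x : differentiable ('D_v h) x.
Proof. by have [_ /(_ v)[d2h _]] := PLo_C2; exact: d2h. Qed.

Lemma PLo_compact_argmin : compact (argmin h).
Proof.
have hc : continuous h.
  by move=> x; exact: differentiable_continuous (PLo_differentiable x).
have [N [_ _ [K cK sub]]] := PLh.
have sub' : argmin h `<=` K.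
  by move=> x xm; apply: sub; apply: filterE.
have [->|/set0P[x0 x0m]] := eqVneq (argmin h) set0; first exact: compact0.
apply: (subclosed_compact _ cK sub').
have -> : argmin h = [set x | h x <= h x0].
  apply/seteqP; split=> x /=; first exact.
  by move=> xx0 y; exact: le_trans xx0 (x0m y).
exact: closed_le_continuous.
Qed.

Lemma PLo_argmin_local_error_bound p : argmin h p ->
  exists2 e, 0 < e & forall x, enorm (x - p) < e ->
    exists2 q, argmin h q & 3 / 4 * mu * enorm (x - q) <= enorm (gradient h x).
Proof.
move=> pm; have [N [[_ [_ _ PLN] _] _ _]] := PLh.
have plm : local_minima h p by apply: filterE.
pose M' := connected_component (local_minima h) p.
have [|oN MN [x0 [Nx0 x0m PL]]] := PLN M'; first by exists p.
have Np : N M' p by apply: MN; exact: connected_component_refl.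
have hx0 : h x0 = h p by apply/eqP; rewrite eq_le x0m// pm.
have [|x NX|e e0 eP] := @PL_local_error_bound _ _ h mu (h p) (N M') p
    PLo_gt0 PLo_differentiable pm erefl.
- exact: open_nbhs_nbhs.
- by rewrite -hx0; exact: PL.
exists e => // x /eP[q hq xq]; exists q => // y.
by rewrite hq.
Qed.

Lemma PLo_critical_point x : (0 < n)%N -> gradient h x = 0 -> local_minima h x \/
  exists2 e, 0 < e & forall y, y != x -> enorm (y - x) < e -> h y < h x.
Proof.
move=> n0 g0; have [N [[_ [_ _ PLN] _] neg _]] := PLh.
have [[M' CM' NMx]|nN] :=
    pselect ((\bigcup_(M' in components (local_minima h)) N M') x); last first.
  by right; apply: negative_definite_peak n0 PLo_C2 g0 (neg x nN g0).
left; have [oN _ [x0 [_ x0m PL]]] := PLN M' CM'.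
have hx : h x <= h x0.
  by have := PL x NMx; rewrite g0 enorm0 expr0n mulr0 subr_le0.
have : nbhs x (N M') by exact: open_nbhs_nbhs.
by apply: filterS => y /x0m; exact: le_trans.
Qed.

End PLoConsequences.

(** * Minimizers depending on a parameter *)

Section Bilevel.
Context {R : realType}.

Lemma enorm_row_mx_le {m n : nat} (u : 'rV[R]_m) (v : 'rV[R]_n) :
  enorm (row_mx u v) <= enorm u + enorm v.
Proof.
rewrite -(ler_pXn2r (n := 2)) ?nnegrE ?addr_ge0 ?enorm_ge0//.
have -> : enorm (row_mx u v) ^+ 2 = enorm u ^+ 2 + enorm v ^+ 2.
  rewrite !enorm_sqr /dotp big_split_ord /=; congr (_ + _).
    by apply: eq_bigr => i _; rewrite row_mxEl.
  by apply: eq_bigr => i _; rewrite row_mxEr.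
have := mulr_ge0 (enorm_ge0 u) (enorm_ge0 v); rewrite sqrrD; lra.
Qed.

(** The estimate from [0] holds up to a largest [s], which cannot be smaller than
    [1], even though the neighborhoods have no uniform size. *)
Lemma pointwise_lipschitz_interval (psi : R -> R) (K : R) :
  (forall s0, 0 <= s0 -> s0 <= 1 -> exists2 e, 0 < e &
    forall s, 0 <= s -> s <= 1 -> `|s - s0| < e ->
      `|psi s - psi s0| <= K * `|s - s0|) ->
  `|psi 1 - psi 0| <= K.
Proof.
move=> H.
pose E := [set s : R | [/\ 0 <= s, s <= 1 & `|psi s - psi 0| <= K * s]].
have E0 : E 0 by split=> //; rewrite subrr normr0 mulr0.
have Es : has_sup E by split; [exists 0|exists 1 => s []].
pose t := sup E.
have t0 : 0 <= t by apply: ub_le_sup; [exact: (proj2 Es)|].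
have t1 : t <= 1 by apply: ge_sup; [exists 0|move=> s []].
have [e e0 eP] := H t t0 t1.
have Et : E t.
  split=> //; have [s Ess] := sup_adherent e0 Es; rewrite -/t => se.
  have [s0 s1 sK] := Ess.
  have st : s <= t by apply: ub_le_sup; [exact: (proj2 Es)|].
  have := eP s s0 s1; rewrite (distrC s) (distrC (psi s)) ger0_norm ?subr_ge0//.
  have tse : t - s < e by lra.
  move=> /(_ tse) B; have := ler_normD (psi t - psi s) (psi s - psi 0).
  by rewrite addrA subrK; lra.
have [tlt|tge] := ltP t 1; last first.
  have tE : t = 1 by apply/eqP; rewrite eq_le t1.
  by have [_ _] := Et; rewrite tE mulr1.
pose s := Num.min 1 (t + e / 2).
have ts : t < s by rewrite lt_min tlt; lra.
have s1 : s <= 1 by rewrite ge_min lexx.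
have s0 : 0 <= s by lra.
have se : s <= t + e / 2 by rewrite ge_min lexx orbT.
suff : E s by move=> /(ub_le_sup (proj2 Es)); rewrite -/t; lra.
split=> //; have := eP s s0 s1; rewrite gtr0_norm ?subr_gt0//.
have ste : s - t < e by lra.
move=> /(_ ste) A; have [_ _ B] := Et.
have := ler_normD (psi s - psi t) (psi t - psi 0).
by rewrite addrA subrK; lra.
Qed.

Lemma convex_set_segment {n : nat} (A : set 'rV[R]_n) x y s :
  convex_set (A : set (convex_lmodType 'rV[R]_n)) -> A x -> A y ->
  0 <= s -> s <= 1 -> A (x + s *: (y - x)).
Proof.
move=> cA Ax Ay s0 s1.
have /set_mem := cA y x (Itv01 s0 s1) (mem_set Ay) (mem_set Ax).
congr A; rewrite /conv /= /unstable.onem.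
by apply/rowP => i; rewrite !mxE /=; ring.
Qed.

Lemma difference_lipschitz {n : nat} (h1 h2 : 'rV[R]_n -> R) (K : R) x y :
  (forall z, differentiable h1 z) -> (forall z, differentiable h2 z) ->
  (forall z, enorm (gradient h1 z - gradient h2 z) <= K) ->
  (h1 x - h2 x) - (h1 y - h2 y) <= K * enorm (x - y).
Proof.
move=> dh1 dh2 HK.
have dh z : differentiable (h1 - h2) z by exact: differentiableB.
have [t [_ _]] := mean_value y (x - y) dh.
rewrite [y + (x - y)]addrC subrK => H.
have -> : h1 x - h2 x - (h1 y - h2 y) = (h1 - h2) x - (h1 - h2) y by [].
rewrite H deriveB; [|exact: diff_derivable|exact: diff_derivable].
rewrite !derive_dotp_gradient// -dotpBr mulrC.
apply: (le_trans (dotp_le _ _)); rewrite ler_wpM2l ?enorm_ge0//.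
Qed.

Lemma exists_enorm_ge {n : nat} (D : R) : (0 < n)%N ->
  exists x : 'rV[R]_n, D <= enorm x.
Proof.
move=> n0; pose i := Ordinal n0; exists (D *: delta_mx 0 i).
have := coord_le_enorm (D *: delta_mx 0 i : 'rV[R]_n) i.
by rewrite !mxE !eqxx mulr1; apply: le_trans; exact: ler_norm.
Qed.

(** The distance to the empty set is infinite, so that the error bound at
    infinity forces minimizers to exist. *)
Lemma error_bound_argmin_neq0 {n : nat} (h : 'rV[R]_n -> R) (D nu : R) :
  (0 < n)%N -> 0 < nu ->
  (forall x, D <= enorm x ->
    (nu%:E * edist_set x (argmin h) <= (enorm (gradient h x))%:E)%E) ->
  argmin h !=set0.
Proof.
move=> n0 nu0 EB; apply/set0P/eqP => S0.
have [x /EB] := @exists_enorm_ge n D n0.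
rewrite S0 /edist_set image_set0 ereal_inf0 gt0_muley ?lte_fin//.
Qed.

Section Regular.
Variables (m d : nat) (Theta : set 'rV[R]_m).
Variables (f g : 'rV[R]_m -> 'rV[R]_d -> R) (mu Lf1 Lgtx : R).
Hypothesis d_ge2 : (2 <= d)%N.
Hypothesis hPL : uniform_PLo mu Theta g.
Hypothesis hreg : regularity Theta f g Lf1 Lgtx.

Let d_gt0 : (0 < d)%N. Proof. exact: ltnW. Qed.

Local Notation S t := (argmin (g t)).

Lemma compact_argmin_g t : Theta t -> compact (S t).
Proof. by move=> /hPL; exact: PLo_compact_argmin. Qed.

Lemma argmin_g_neq0 t : Theta t -> S t !=set0.
Proof.
move=> Tt; have [D [nu [_ nu0 EB]]] := g_error_bound hreg.
by apply: (@error_bound_argmin_neq0 _ _ D nu) => // x; exact: EB.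
Qed.

Lemma argmin_g_gradient t p : Theta t -> S t p -> gradient (g t) p = 0.
Proof.
move=> Tt Sp; apply: enorm_eq0; apply/eqP; rewrite eq_le enorm_ge0 andbT.
apply: slope_gradient_le => //; first exact: (PLo_differentiable (hPL Tt)).
by move=> z; rewrite mul0r addr0.
Qed.

Lemma real_error_bound : exists D nu, [/\ 0 < D, 0 < nu &
  forall t x, Theta t -> D <= enorm x ->
    nu * sdist x (S t) <= enorm (gradient (g t) x)].
Proof.
have [D [nu [D0 nu0 EB]]] := g_error_bound hreg.
exists D, nu; split=> // t x Tt /(EB t x Tt).
have [p [_ _ ->]] := sdistP x (compact_argmin_g Tt) (argmin_g_neq0 Tt).
by rewrite -EFinM lee_fin.
Qed.

Lemma gradient_variation t t' x : Theta t -> Theta t' ->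
  enorm (gradient (g t) x - gradient (g t') x) <= `|Lgtx| * enorm (t - t').
Proof.
move=> Tt Tt'; apply: (le_trans (g_lipschitz_tx hreg x Tt Tt')).
by rewrite ler_wpM2r ?enorm_ge0// ler_norm.
Qed.

Lemma uniform_radius : exists2 r, 0 < r & forall t x, Theta t ->
  sdist x (S t) <= r -> mu / 2 * sdist x (S t) <= enorm (gradient (g t) x).
Proof.
have [r3 [Lg3 [r30 HL]]] := g_hessian_lipschitz hreg.
pose L := Num.max 1 Lg3; have L0 : 0 < L by rewrite lt_max ltr01.
have [[t0 Tt0]|noT] := pselect (exists t, Theta t); last first.
  by exists 1 => // t x Tt; case: noT; exists t.
have mu0 := PLo_gt0 (hPL Tt0).
exists (Num.min r3 (mu / (8 * L))).
  by rewrite lt_min r30 divr_gt0// mulr_gt0.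
move=> t x Tt; rewrite le_min => /andP[xr3 xL].
apply: (@uniform_error_bound _ _ _ mu L r3 (S t)) => //.
- exact: (PLo_differentiable (hPL Tt)).
- exact: (PLo_derive_differentiable (hPL Tt)).
- exact: compact_argmin_g.
- exact: argmin_g_neq0.
- by move=> p; exact: argmin_g_gradient.
- by move=> p; exact: (PLo_argmin_local_error_bound (hPL Tt)).
move=> y z yr zr; apply: (@le_trans _ _ (Lg3 * enorm (y - z))).
  apply: HL => //.
  have [_ [_ _ ->]] := sdistP y (compact_argmin_g Tt) (argmin_g_neq0 Tt).
  have [_ [_ _ ->]] := sdistP z (compact_argmin_g Tt) (argmin_g_neq0 Tt).
  by rewrite ge_max !lee_fin yr.
by rewrite ler_wpM2r ?enorm_ge0// le_max lexx orbT.
Qed.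

(** Minimizers of [g t] are almost critical for [g t0]: far away they are close
    to [S t0] by the error bound at infinity; in a fixed ball they almost
    minimize [g t0], because [g t - g t0] has a small Lipschitz constant. *)
Lemma upper_hemicontinuous t0 r : Theta t0 -> 0 < r ->
  exists2 e, 0 < e & forall t x, Theta t -> enorm (t - t0) < e -> S t x ->
    sdist x (S t0) <= r.
Proof.
move=> Tt0 r0; have [D [nu [D0 nu0 EB]]] := real_error_bound.
have cS := compact_argmin_g Tt0; have [p0 Sp0] := argmin_g_neq0 Tt0.
have dg t : Theta t -> forall x, differentiable (g t) x.
  by move=> /hPL; exact: PLo_differentiable.
have gc : continuous (g t0).
  by move=> x; exact: differentiable_continuous (dg t0 Tt0 x).
have dc : continuous (sdist ^~ (S t0)).
  by apply: sdist_continuous => //; exists p0.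
have [eta eta0 etaP] : exists2 eta, 0 < eta & forall x, enorm x <= D ->
    r <= sdist x (S t0) -> g t0 p0 + eta <= g t0 x.
  pose K := [set x : 'rV[R]_d | enorm x <= D] `&` [set x | r <= sdist x (S t0)].
  have cK : compact K.
    apply: (@closed_enorm_compact _ _ _ D); last by move=> x [].
    apply: closedI; first exact: (closed_le_continuous enorm_continuous).
    exact: (closed_ge_continuous dc).
  have [K0|/set0P K0] := eqVneq K set0.
    exists 1 => // x xD xr; have : K x by [].
    by rewrite K0.
  have [x [_ /= xr] xm] := compact_min gc cK K0.
  exists (g t0 x - g t0 p0); last by move=> y yD yr; rewrite addrC subrK; exact: xm.
  rewrite subr_gt0 lt_neqAle Sp0 andbT; apply/eqP => gx.
  have Sx : S t0 x by move=> y; rewrite -gx.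
  by move: xr; rewrite (sdist_mem cS Sx) leNgt r0.
pose La := `|Lgtx| + 1; have La0 : 0 < La by rewrite ltr_wpDl.
have B0 : 0 < D + enorm p0 by rewrite ltr_wpDr ?enorm_ge0.
exists (Num.min (nu * r / La) (eta / La / (D + enorm p0))).
  by rewrite lt_min !divr_gt0// mulr_gt0.
move=> t x Tt; rewrite lt_min !ltr_pdivlMr// => /andP[te1 te2] Sx.
have var z : enorm (gradient (g t0) z - gradient (g t) z) <= enorm (t - t0) * La.
  apply: (le_trans (gradient_variation z Tt0 Tt)).
  rewrite (enormC t0) mulrC ler_wpM2l ?enorm_ge0//.
  by rewrite /La lerDl.
have [Dx|/ltW Dx] := leP D (enorm x).
  have := EB t0 x Tt0 Dx; have := var x; rewrite (argmin_g_gradient Tt Sx) subr0 => A B.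
  by rewrite -(ler_pM2l nu0); lra.
rewrite leNgt; apply/negP => /ltW/(etaP x Dx) gx.
have := difference_lipschitz x p0 (dg t0 Tt0) (dg t Tt) var.
have := Sx p0.
have : enorm (t - t0) * La * enorm (x - p0)
    <= enorm (t - t0) * La * (D + enorm p0).
  rewrite ler_wpM2l ?mulr_ge0 ?enorm_ge0 ?(ltW La0)//.
  by have := enormD x (- p0); rewrite enormN; lra.
have : enorm (t - t0) * La * (D + enorm p0) < eta.
  by rewrite mulrAC.
lra.
Qed.

Lemma argmin_intermediate_value t (phi : 'rV[R]_d -> R) a b r :
  Theta t -> continuous phi -> S t a -> S t b -> phi a < r -> r < phi b -> exists2 p, S t p & phi p = r.
Proof.
move=> Tt phic Sa Sb ar rb; have PLt := hPL Tt.
have [D [nu [_ nu0 EB]]] := real_error_bound.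
have [v|c|x||p pm pr] := @mountain_pass _ _ (g t) phi a b (g t a) r d_ge2
  (PLo_differentiable PLt) _ _ _ phic Sa erefl _ ar rb.
- move=> x; apply: differentiable_continuous.
  exact: (PLo_derive_differentiable PLt).
- apply: (@error_bound_compact_sublevel _ _ (g t) D nu a) => //.
  + exact: (PLo_differentiable PLt).
  + exact: compact_argmin_g.
  + by move=> x; exact: EB.
- exact: (PLo_critical_point PLt).
- by apply/eqP; rewrite eq_le Sa Sb.
by exists p => // y; rewrite pm.
Qed.

Let k := 2 * Lgtx / mu.

(** For the second half: on [S t0] the distance to [S t] never takes a value
    between [k |t - t0|] and [r], by the uniform error bound; being below [r]
    somewhere, it is below [k |t - t0|] everywhere, as [S t0] is connected. *)
Lemma argmin_locally_lipschitz t0 : Theta t0 ->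
  exists2 e, 0 < e & forall t, Theta t -> enorm (t - t0) < e ->
    (forall x, S t x -> exists2 p, S t0 p & enorm (x - p) <= k * enorm (t - t0)) /\
    (forall p, S t0 p -> exists2 x, S t x & enorm (x - p) <= k * enorm (t - t0)).
Proof.
move=> Tt0; have [r r0 EB] := uniform_radius.
have mu0 := PLo_gt0 (hPL Tt0).
have EB' t t' x : Theta t -> Theta t' -> S t x -> sdist x (S t') <= r ->
    sdist x (S t') <= k * enorm (t - t').
  move=> Tt Tt' Sx /(EB t' x Tt') A.
  have := g_lipschitz_tx hreg x Tt' Tt; rewrite (argmin_g_gradient Tt Sx) subr0 => B.
  have -> : k * enorm (t - t') = (mu / 2)^-1 * (Lgtx * enorm (t' - t)).
    by rewrite (enormC t') /k; field; lra.
  by rewrite ler_pdivlMl ?(le_trans A B)//; lra.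
have [e e0 usc] := upper_hemicontinuous Tt0 r0.
have La0 : 0 < `|k| + 1 by rewrite ltr_wpDl.
exists (Num.min e (r / (`|k| + 1))); first by rewrite lt_min e0 divr_gt0.
move=> t Tt; rewrite lt_min ltr_pdivlMr// => /andP[te tr].
have kr : k * enorm (t - t0) < r.
  apply: le_lt_trans tr; rewrite mulrC ler_wpM2l ?enorm_ge0//.
  by have := ler_norm k; lra.
have [cS0 cS] := (compact_argmin_g Tt0, compact_argmin_g Tt).
split=> [x Sx|p Sp].
  have [p [Sp Ep _]] := sdistP x cS0 (argmin_g_neq0 Tt0).
  by exists p => //; rewrite -Ep; apply: EB' => //; exact: usc Sx.
have EBp q : S t0 q -> sdist q (S t) <= r -> sdist q (S t) <= k * enorm (t - t0).
  by rewrite enormC; exact: EB'.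
have pr : sdist p (S t) <= r.
  rewrite leNgt; apply/negP => rp.
  have [x Sx] := argmin_g_neq0 Tt.
  have xr : sdist x (S t0) <= r by exact: usc Sx.
  have [p1 [Sp1 Ep1 _]] := sdistP x cS0 (argmin_g_neq0 Tt0).
  have p1r : sdist p1 (S t) <= r.
    by rewrite (le_trans (sdist_le p1 cS Sx))// enormC -Ep1.
  have p1r' : sdist p1 (S t) < r by exact: le_lt_trans (EBp p1 Sp1 p1r) kr.
  have [q Sq qr] := argmin_intermediate_value Tt0
    (sdist_continuous cS (argmin_g_neq0 Tt)) Sp1 Sp p1r' rp.
  by have := EBp q Sq; rewrite qr lexx => /(_ isT); rewrite leNgt kr.
have [x [Sx Ex _]] := sdistP p cS (argmin_g_neq0 Tt).
by exists x => //; rewrite enormC -Ex; exact: EBp.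
Qed.

Lemma Fmax_attained t : Theta t -> exists x, [/\ S t x,
  forall y, S t y -> f t y <= f t x & Fmax f g t = f t x].
Proof.
move=> Tt.
have fc : continuous (f t).
  apply: (@lipschitz_enorm_continuous _ _ _ `|Lf1|) => x y.
  apply: (le_trans (f_lipschitz hreg x y Tt Tt)).
  apply: (@le_trans _ _ (`|Lf1| * enorm (row_mx (t - t) (x - y)))).
    by rewrite ler_wpM2r ?enorm_ge0// ler_norm.
  rewrite ler_wpM2l// (le_trans (enorm_row_mx_le _ _))//.
  by rewrite subrr enorm0 add0r.
have [|x /set_mem Sx xm] :=
  compact_EVT_max (argmin_g_neq0 Tt) (compact_argmin_g Tt) (f := f t).
  exact: continuous_subspaceT.
have xm' y : S t y -> f t y <= f t x by move=> /mem_set/xm.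
exists x; split=> //; apply/eqP; rewrite eq_le; apply/andP; split.
  apply: ge_sup; first by exists (f t x), x.
  by move=> _ [y Sy <-]; exact: xm'.
apply: ub_le_sup; last by exists x.
by exists (f t x) => _ [y Sy <-]; exact: xm'.
Qed.

Lemma Lf1_ge0 t : Theta t -> 0 <= Lf1.
Proof.
move=> Tt; have [x x1] := @exists_enorm_ge d 1 d_gt0.
have := le_trans (normr_ge0 _) (f_lipschitz hreg x 0 Tt Tt).
rewrite pmulr_lge0//; apply: enorm_gt0; apply/eqP => E.
suff x0 : x = 0 by move: x1; rewrite x0 enorm0 ler10.
apply/rowP => i; have /rowP/(_ (rshift m i)) := E.
by rewrite row_mxEr subr0 !mxE.
Qed.

Lemma Fmax_locally_lipschitz t0 : Theta t0 ->
  exists2 e, 0 < e & forall t, Theta t -> enorm (t - t0) < e ->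
    `|Fmax f g t - Fmax f g t0| <= Lf1 * (1 + k) * enorm (t - t0).
Proof.
move=> Tt0; have [e e0 eP] := argmin_locally_lipschitz Tt0.
exists e => // t Tt te; have [H1 H2] := eP t Tt te.
have Lf0 := Lf1_ge0 Tt.
have bound x p : enorm (x - p) <= k * enorm (t - t0) ->
    `|f t x - f t0 p| <= Lf1 * (1 + k) * enorm (t - t0).
  move=> xp; apply: (le_trans (f_lipschitz hreg x p Tt Tt0)).
  rewrite -mulrA ler_wpM2l// (le_trans (enorm_row_mx_le _ _))//.
  by rewrite mulrDl mul1r lerD2l.
have [x [Sx xm ->]] := Fmax_attained Tt.
have [p [Sp pm ->]] := Fmax_attained Tt0.
have [p' Sp' /bound] := H1 x Sx; have [x' Sx' /bound] := H2 p Sp.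
rewrite !ler_norml => /andP[A _] /andP[_ B].
have := pm p' Sp'; have := xm x' Sx'.
by move=> C E; apply/andP; split; lra.
Qed.

Lemma Fmax_lipschitz t t' :
  convex_set (Theta : set (convex_lmodType 'rV[R]_m)) -> Theta t -> Theta t' ->
  `|Fmax f g t - Fmax f g t'| <= Lf1 * (1 + k) * enorm (t - t').
Proof.
move=> cT Tt Tt'.
pose c (s : R) := t' + s *: (t - t').
have Tc s : 0 <= s -> s <= 1 -> Theta (c s) by exact: convex_set_segment.
have cB s s' : enorm (c s - c s') = enorm (t - t') * `|s - s'|.
  have -> : c s - c s' = (s - s') *: (t - t').
    by rewrite /c opprD addrACA subrr add0r -scalerBl.
  by rewrite enormZ mulrC.
have := @pointwise_lipschitz_interval (fun s => Fmax f g (c s))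
  (Lf1 * (1 + k) * enorm (t - t')).
have -> : c 1 = t by rewrite /c scale1r addrC subrK.
have -> : c 0 = t' by rewrite /c scale0r addr0.
apply=> s0 s00 s01; have [e e0 eP] := Fmax_locally_lipschitz (Tc s0 s00 s01).
have N0 : 0 < enorm (t - t') + 1 by rewrite ltr_wpDl ?enorm_ge0.
exists (e / (enorm (t - t') + 1)); first by rewrite divr_gt0.
move=> s ss0 ss1; rewrite ltr_pdivlMr// => ss.
rewrite -mulrA -cB; apply: eP; first exact: Tc.
by rewrite cB; apply: le_lt_trans ss; rewrite mulrC ler_wpM2l//; lra.
Qed.

End Regular.
End Bilevel.

(* The first conjunct says that the maximum defining Fmax exists.              *)
Theorem corollary3p5 (R : realType) (m d : nat) (Theta : set 'rV[R]_m)
    (f g : 'rV[R]_m -> 'rV[R]_d -> R) (mu Lf1 Lgtx : R)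
    (hm : (1 <= m)%N) (hd : (2 <= d)%N)
    (Theta_neq0 : Theta !=set0) (Theta_compact : compact Theta)
    (Theta_convex : convex_set (Theta : set (convex_lmodType 'rV[R]_m)))
    (hmu : 0 < mu) (hPL : uniform_PLo mu Theta g)
    (hreg : regularity Theta f g Lf1 Lgtx) :
  (forall t, Theta t -> exists x, [/\ argmin (g t) x,
     forall y, argmin (g t) y -> f t y <= f t x & Fmax f g t = f t x]) /\
  (forall t t', Theta t -> Theta t' ->
     `|Fmax f g t - Fmax f g t'| <= Lf1 * (1 + 2 * Lgtx / mu) * enorm (t - t')).
Proof.
split=> [t Tt|t t' Tt Tt']; first exact: Fmax_attained hPL hreg _ Tt.
exact: (Fmax_lipschitz hd hPL hreg Theta_convex Tt Tt').
Qed.
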